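(* Let $k$ be a field, let $V,W$ be finite dimensional $k$-linear spaces and let $u\in\mathcal L(V)\otimes\mathcal L(W)$. The following conditions are equivalent: (i) there exists a model for $u$; (ii) there exists a maximal model for $u$; (iii) there exists a minimal model for $u$; (iv) $u$ satisfies the following infinite sequence of conditions: $u_0:=u$ is invertible, $u_1:=(t\otimes id)u_0^{-1}$ is invertible, $u_2:=(t\otimes id)u_1^{-1}$ is invertible, $u_3:=(t\otimes id)u_2^{-1}$ is invertible, and so on (i.e. inductively, for every $n\ge 0$ the element $u_n$ is invertible, where $u_{n+1}:=(t\otimes id)u_n^{-1}$). Moreover, if these conditions are satisfied then the minimal model for $u$ may be characterised as the unique bi-faithful model for $u$.
   Context: All $k$-algebras are unital with unital morphisms; all coalgebras are counital with counital morphisms. $\mathcal L(V)$ is the algebra of $k$-linear endomorphisms of $V$, tensor products are over $k$, and $t:\mathcal L(V)\to\mathcal L(V^* )$ is the transposition, $t(T)(f)=f\circ T$ (an antimultiplicative unital map). We identify $V^{**}=V$, so $t$ also denotes $\mathcal L(V^* )\to\mathcal L(V)$; invertibility of $u_n$ is in $\mathcal L(V)\otimes\mathcal L(W)$ for $n$ even and in $\mathcal L(V^* )\otimes\mathcal L(W)$ for $n$ odd. Subscripts such as $v_{12},v_{13}$ are the usual leg-numbering notation. Let $(H,m,1,\Delta,\varepsilon,S)$ be a Hopf $k$-algebra. $H^\circ\subset H^*$ denotes the finite dual (linear forms whose kernel contains a finite-codimensional ideal), a Hopf algebra with the structure dual to that of $H$. A (finite dimensional) representation of $H$ is a morphism of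 algebras $\pi:H\to\mathcal L(W)$; its space of coefficients is the subcoalgebra $\mathcal C_\pi=\{f\circ\pi\mid f\in\mathcal L(W)^*\}\subset H^\circ$. A (finite dimensional) corepresentation of $H$ is an element $v\in\mathcal L(V)\otimes H$ with $(id\otimes\Delta)v=v_{12}v_{13}$ and $(id\otimes\varepsilon)v=1$; its space of coefficients is the subcoalgebra $\mathcal C_v=\{(f\otimes id)v\mid f\in\mathcal L(V)^*\}\subset H$. For a subcoalgebra $C$ of a Hopf algebra with antipode $S$, $\langle C\rangle$ is the unital subalgebra generated by $\bigcup_{k\ge0}S^k(C)$ (a Hopf subalgebra). A model for $u\in\mathcal L(V)\otimes\mathcal L(W)$ is a triple $(H,v,\pi)$ with $H$ a Hopf $k$-algebra, $v\in\mathcal L(V)\otimes H$ a corepresentation and $\pi:H\to\mathcal L(W)$ a representation such that $(id\otimes\pi)v=u$. The model is left-faithful if $\langle\mathcal C_v\rangle=H$; right-faithful if $\langle\mathcal C_\pi\rangle\subset H^\circ$ is dense in $H^*$, i.e. the only $h\in H$ with $f(h)=0$ for all $f\in\langle\mathcal C_\pi\rangle$ is $h=0$; bi-faithful if both. A morphism of left-faithful models $(H_1,v_1,\pi_1)\to(H_2,v_2,\pi_2)$ of $u$ is a Hopf algebra morphism $f:H_1\to H_2$ with $(id\otimes f)v_1=v_2$ and $\pi_1=\pi_2f$. The maximal model for $u$ is the universally repelling (initial) object of the category of left-faithful models for $u$, and the minimal model is the universally attracting (terminal) object. Uniqueness of models is understood up to isomorphism of left-faithful models. *)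

(* Defs.v *)
From HB Require Import structures.
From mathcomp Require Import all_boot all_order all_algebra.
From mathcomp Require Import boolp classical_sets.

Set Implicit Arguments.
Unset Strict Implicit.
Unset Printing Implicit Defensive.

Import GRing.Theory.
Local Open Scope ring_scope.

(* Associative unital k-algebras. MathComp's algType excludes the zero ring,
   hence excludes L(V) for V = 0. The multiplication is part of the mixin,
   and every k-algebra gets its pzRingType structure afterwards, because a
   structure inheriting from both PzRing and Lmodule would lie below
   MathComp's nonzero algebras, which Hierarchy Builder does not allow. *)
HB.mixin Record Lmodule_isKAlgebra (k : fieldType) A of GRing.Lmodule k A := {
  kone : A;
  kmul : A -> A -> A;
  kmulA : associative kmul;
  kmul1r : left_id kone kmul;
  kmulr1 : right_id kone kmul;
  kmulDl : left_distributive kmul +%R;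
  kmulDr : right_distributive kmul +%R;
  kmulZl : forall (c : k) (x y : A), c *: kmul x y = kmul (c *: x) y;
  kmulZr : forall (c : k) (x y : A), c *: kmul x y = kmul x (c *: y)
}.

#[short(type="kalgType")]
HB.structure Definition KAlgebra (k : fieldType) :=
  {A of Lmodule_isKAlgebra k A & GRing.Lmodule k A}.

HB.instance Definition _ (k : fieldType) (A : kalgType k) :=
  GRing.Zmodule_isPzRing.Build A kmulA kmul1r kmulr1 kmulDl kmulDr.

Lemma kscalerAl (k : fieldType) (A : kalgType k) (c : k) (x y : A) :
  c *: (x * y) = (c *: x) * y.
Proof. exact: kmulZl. Qed.

Lemma kscalerAr (k : fieldType) (A : kalgType k) (c : k) (x y : A) :
  c *: (x * y) = x * (c *: y).
Proof. exact: kmulZr. Qed.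

HB.instance Definition _ (k : fieldType) := Lmodule_isKAlgebra.Build k k^o
  (@mulrA k) (@mul1r k) (@mulr1 k) (@mulrDl k) (@mulrDr k)
  (@scalerAl k k^o) (@scalerAr k k^o).

Definition invertible (k : fieldType) (A : kalgType k) (x : A) : Prop :=
  exists y : A, x * y = 1 /\ y * x = 1.

(* The two-sided inverse of x; the value is 0 when x is not invertible. *)
Definition kinv (k : fieldType) (A : kalgType k) (x : A) : A :=
  xget 0 [set y : A | x * y = 1 /\ y * x = 1]%classic.

(* The formal sum a1 (x) b1 + ... + an (x) bn is coded by the sequence
   [:: (a1, b1); ...; (an, bn)], and tens_eq is the congruence generated by
   commutativity of the sum and bilinearity of (x). Opposites and scalar
   multiples are obtained by acting on the left-hand factors. *)
Inductive tens_eq (k : fieldType) (A B : lmodType k) :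
    seq (A * B) -> seq (A * B) -> Prop :=
| tens_refl s : tens_eq s s
| tens_sym s t : tens_eq s t -> tens_eq t s
| tens_trans s t r : tens_eq s t -> tens_eq t r -> tens_eq s r
| tens_cat s s' t t' :
    tens_eq s s' -> tens_eq t t' -> tens_eq (s ++ t) (s' ++ t')
| tens_catC s t : tens_eq (s ++ t) (t ++ s)
| tens_pure0 b : tens_eq [:: (0, b)] [::]
| tens_pureDl a a' b : tens_eq [:: (a + a', b)] [:: (a, b); (a', b)]
| tens_pureDr a b b' : tens_eq [:: (a, b + b')] [:: (a, b); (a, b')]
| tens_pureZ (c : k) a b : tens_eq [:: (c *: a, b)] [:: (a, c *: b)].

Section TensorProduct.
Variables (k : fieldType) (A B : lmodType k).

Definition tens_rel : rel (seq (A * B)) := fun s t => `[< tens_eq s t >].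

Fact tens_rel_refl : reflexive tens_rel.
Proof. by move=> s; apply/asboolP; exact: tens_refl. Qed.

Fact tens_rel_sym : symmetric tens_rel.
Proof. by move=> s t; apply/asboolP/asboolP; exact: tens_sym. Qed.

Fact tens_rel_trans : transitive tens_rel.
Proof.
by move=> t s r /asboolP st /asboolP tr; apply/asboolP; exact: tens_trans tr.
Qed.

Canonical tens_equiv := EquivRel tens_rel tens_rel_refl tens_rel_sym
  tens_rel_trans.

Definition tensor : Type := {eq_quot tens_rel}%qT.

HB.instance Definition _ : EqQuotient _ tens_rel tensor :=
  EqQuotient.on tensor.
HB.instance Definition _ := Choice.on tensor.

Implicit Types (s t : seq (A * B)) (x y z : tensor).

Definition tens_class s : tensor := \pi_tensor%qT s.

Lemma tens_classP s t : tens_class s = tens_class t <-> tens_eq s t.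
Proof.
by split=> [/eqmodP/asboolP|st]; last apply/eqmodP/asboolP.
Qed.

Lemma tens_classK x : tens_class (repr x) = x.
Proof. by rewrite /tens_class reprK. Qed.

Lemma tens_eq_repr s : tens_eq (repr (tens_class s)) s.
Proof. by apply/tens_classP; rewrite tens_classK. Qed.

Definition pure (a : A) (b : B) : tensor := tens_class [:: (a, b)].

Definition tens_zero : tensor := tens_class [::].
Definition tens_add x y : tensor := tens_class (repr x ++ repr y).
Definition tens_scale (c : k) x : tensor :=
  tens_class [seq (c *: p.1, p.2) | p <- repr x].

Lemma tens_classD s t :
  tens_add (tens_class s) (tens_class t) = tens_class (s ++ t).
Proof. by apply/tens_classP; apply: tens_cat; apply: tens_eq_repr. Qed.

Lemma tens_eq_scale c s t : tens_eq s t ->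
  tens_eq [seq (c *: p.1, p.2) | p <- s] [seq (c *: p.1, p.2) | p <- t].
Proof.
elim=> {s t} [s|s t _ IH|s t r _ IH1 _ IH2|s s' t t' _ IH1 _ IH2|s t|b
  |a a' b|a b b'|d a b] /=.
- exact: tens_refl.
- exact: tens_sym.
- exact: tens_trans IH2.
- by rewrite !map_cat; apply: tens_cat.
- by rewrite !map_cat; apply: tens_catC.
- by rewrite scaler0; apply: tens_pure0.
- by rewrite scalerDr; apply: tens_pureDl.
- exact: tens_pureDr.
- by rewrite scalerA mulrC -scalerA; apply: tens_pureZ.
Qed.

Lemma tens_classZ c s :
  tens_scale c (tens_class s) = tens_class [seq (c *: p.1, p.2) | p <- s].
Proof. by apply/tens_classP/tens_eq_scale/tens_eq_repr. Qed.

Fact tens_addA : associative tens_add.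
Proof.
move=> x y z; rewrite -[x]tens_classK -[y]tens_classK -[z]tens_classK.
by rewrite !tens_classD catA.
Qed.

Fact tens_addC : commutative tens_add.
Proof.
move=> x y; rewrite -[x]tens_classK -[y]tens_classK !tens_classD.
by apply/tens_classP/tens_catC.
Qed.

Fact tens_add0 : left_id tens_zero tens_add.
Proof. by move=> x; rewrite -[x]tens_classK tens_classD. Qed.

Lemma tens_class_cons p s :
  tens_class (p :: s) = tens_add (pure p.1 p.2) (tens_class s).
Proof. by rewrite tens_classD; case: p. Qed.

Lemma tens_addACA : interchange tens_add tens_add.
Proof.
move=> x y z t; rewrite -!tens_addA; congr tens_add.
by rewrite !tens_addA; congr tens_add; apply: tens_addC.
Qed.

Fact tens_scaleDl x c d :
  tens_scale (c + d) x = tens_add (tens_scale c x) (tens_scale d x).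
Proof.
rewrite -[x]tens_classK !tens_classZ; elim: (repr x) => [|p s IH] /=.
  by rewrite tens_add0.
rewrite !tens_class_cons {}IH /= tens_addACA; congr tens_add.
by rewrite scalerDl /pure tens_classD; apply/tens_classP/tens_pureDl.
Qed.

Fact tens_scale0 x : tens_scale 0 x = tens_zero.
Proof.
rewrite -[x]tens_classK tens_classZ; elim: (repr x) => [|p s IH] //=.
rewrite tens_class_cons IH /= scale0r -[RHS]tens_add0; congr tens_add.
by apply/tens_classP/tens_pure0.
Qed.

Fact tens_scale1 : left_id 1 tens_scale.
Proof.
move=> x; rewrite -[x]tens_classK tens_classZ; congr tens_class.
by apply: map_id_in => -[a b] _ /=; rewrite scale1r.
Qed.

Fact tens_scaleA c d x : tens_scale c (tens_scale d x) = tens_scale (c * d) x.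
Proof.
rewrite -[x]tens_classK !tens_classZ -map_comp; congr tens_class.
by apply: eq_map => -[a b] /=; rewrite scalerA.
Qed.

Fact tens_scaleDr : right_distributive tens_scale tens_add.
Proof.
move=> c x y; rewrite -[x]tens_classK -[y]tens_classK.
by rewrite !(tens_classD, tens_classZ) map_cat.
Qed.

Fact tens_addN : left_inverse tens_zero (tens_scale (-1)) tens_add.
Proof.
by move=> x; rewrite -{2}[x]tens_scale1 -tens_scaleDl addNr tens_scale0.
Qed.

HB.instance Definition _ := GRing.isZmodule.Build tensor
  tens_addA tens_addC tens_add0 tens_addN.

HB.instance Definition _ := GRing.Zmodule_isLmodule.Build k tensor
  tens_scaleA tens_scale1 tens_scaleDr tens_scaleDl.

Lemma tens_class_sum s : tens_class s = \sum_(p <- s) pure p.1 p.2.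
Proof.
by elim: s => [|p s IH]; rewrite ?big_nil // big_cons -IH tens_class_cons.
Qed.

Lemma tensE x : x = \sum_(p <- repr x) pure p.1 p.2.
Proof. by rewrite -tens_class_sum tens_classK. Qed.

Lemma tens_ind (P : tensor -> Prop) :
  (forall a b, P (pure a b)) -> P 0 -> (forall x y, P x -> P y -> P (x + y)) ->
  forall x, P x.
Proof. by move=> Pp P0 PD x; rewrite [x]tensE; elim/big_ind: _. Qed.

Lemma pureDl a a' b : pure (a + a') b = pure a b + pure a' b.
Proof. by rewrite [RHS]tens_classD; apply/tens_classP/tens_pureDl. Qed.

Lemma pureDr a b b' : pure a (b + b') = pure a b + pure a b'.
Proof. by rewrite [RHS]tens_classD; apply/tens_classP/tens_pureDr. Qed.

Lemma pureZl c a b : pure (c *: a) b = c *: pure a b.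
Proof. by rewrite [RHS]tens_classZ. Qed.

Lemma pureZr c a b : pure a (c *: b) = c *: pure a b.
Proof. by rewrite -pureZl; apply/esym/tens_classP/tens_pureZ. Qed.

Lemma pure0l b : pure 0 b = 0.
Proof. by apply/tens_classP/tens_pure0. Qed.

Lemma pure0r a : pure a 0 = 0.
Proof. by rewrite -(scale0r 0) pureZr scale0r. Qed.

Lemma pure_linearl b : linear (pure^~ b).
Proof. by move=> c a a'; rewrite pureDl pureZl. Qed.

Lemma pure_linearr a : linear (pure a).
Proof. by move=> c b b'; rewrite pureDr pureZr. Qed.

End TensorProduct.

Notation "A '\ox' B" := (tensor A B)
  (at level 40, left associativity, format "A  '\ox'  B").
Notation "a '\oe' b" := (pure a b)
  (at level 40, left associativity, format "a  '\oe'  b").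

Section TensorLift.
Variables (k : fieldType) (A B C : lmodType k).

Definition bilin (f : A -> B -> C) : Prop :=
  (forall b, linear (f^~ b)) /\ (forall a, linear (f a)).

(* The map A \ox B -> C induced by f; meaningful when f is bilinear. *)
Definition tens_lift (f : A -> B -> C) (x : A \ox B) : C :=
  \sum_(p <- repr x) f p.1 p.2.

Variable f : A -> B -> C.
Hypothesis bf : bilin f.

Lemma tens_lift_class s : tens_lift f (tens_class s) = \sum_(p <- s) f p.1 p.2.
Proof.
have fD b : {morph f^~ b : a a' / a + a'}.
  by move=> a a'; have := bf.1 b 1 a a'; rewrite !scale1r.
have fDr a : {morph f a : b b' / b + b'}.
  by move=> b b'; have := bf.2 a 1 b b'; rewrite !scale1r.
have f0 b : f 0 b = 0 by apply: (addrI (f 0 b)); rewrite -fD !addr0.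
have f0r a : f a 0 = 0 by apply: (addrI (f a 0)); rewrite -fDr !addr0.
rewrite /tens_lift; move: (repr _) (tens_eq_repr s) => t.
elim=> {s t} [//|//|s t r _ -> _ -> //
  |s s' t t' _ IH1 _ IH2|s t|b|a a' b|a b b'|d a b].
- by rewrite !big_cat /= IH1 IH2.
- by rewrite !big_cat /= addrC.
- by rewrite big_cons !big_nil addr0 f0.
- by rewrite !big_cons !big_nil !addr0 fD.
- by rewrite !big_cons !big_nil !addr0 fDr.
- have := bf.1 b d a 0; have := bf.2 a d b 0.
  by rewrite !big_cons !big_nil /= f0 f0r !addr0 => -> ->.
Qed.

Lemma tens_lift_pure a b : tens_lift f (a \oe b) = f a b.
Proof. by rewrite tens_lift_class big_cons big_nil addr0. Qed.

Lemma tens_lift_linear : linear (tens_lift f).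
Proof.
move=> c x y; rewrite -[x]tens_classK -[y]tens_classK.
rewrite [c *: _]tens_classZ [_ + _]tens_classD !tens_lift_class big_cat.
rewrite big_map scaler_sumr; congr (_ + _); apply: eq_bigr => -[a b] _ /=.
have := bf.1 b c a 0; rewrite addr0 => ->.
have -> : f 0 b = 0; last by rewrite addr0.
by have := bf.1 b (-1) 0 0; rewrite scaler0 addr0 scaleN1r addNr.
Qed.

End TensorLift.

Lemma tens_linear_ext (k : fieldType) (A B C : lmodType k)
    (f g : {linear A \ox B -> C}) :
  (forall a b, f (a \oe b) = g (a \oe b)) -> f =1 g.
Proof.
by move=> fg; apply: tens_ind => [//||x y IHx IHy]; rewrite ?linear0 ?linearD//
  IHx IHy.
Qed.

Section TensorMap.
Variables (k : fieldType) (A A' B B' : lmodType k).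
Variables (f : {linear A -> A'}) (g : {linear B -> B'}).

Let fg (a : A) (b : B) : A' \ox B' := f a \oe g b.

Let fg_bilin : bilin fg.
Proof.
split=> [b c a a'|a c b b']; rewrite /fg linearP.
- exact: pure_linearl.
- exact: pure_linearr.
Qed.

Definition tens_map : A \ox B -> A' \ox B' := tens_lift fg.

HB.instance Definition _ := GRing.isLinear.Build k (A \ox B) (A' \ox B') _
  tens_map (tens_lift_linear fg_bilin).

Lemma tens_map_pure a b : tens_map (a \oe b) = f a \oe g b.
Proof. exact: tens_lift_pure. Qed.

End TensorMap.

Section TensorUnit.
Variables (k : fieldType) (A : lmodType k).

Let scalel (c : k^o) (a : A) : A := (c : k) *: a.
Let scaler (a : A) (c : k^o) : A := (c : k) *: a.

Let scalel_bilin : bilin scalel.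
Proof.
split=> [a c d d'|d c a a']; rewrite /scalel.
- by rewrite scalerDl scalerA.
- by rewrite scalerDr !scalerA mulrC.
Qed.

Let scaler_bilin : bilin scaler.
Proof.
split=> [d c a a'|a c d d']; rewrite /scaler.
- by rewrite scalerDr !scalerA mulrC.
- by rewrite scalerDl scalerA.
Qed.

Definition tens_unitl : k^o \ox A -> A := tens_lift scalel.
Definition tens_unitr : A \ox k^o -> A := tens_lift scaler.

HB.instance Definition _ := GRing.isLinear.Build k (k^o \ox A) A _
  tens_unitl (tens_lift_linear scalel_bilin).
HB.instance Definition _ := GRing.isLinear.Build k (A \ox k^o) A _
  tens_unitr (tens_lift_linear scaler_bilin).

Lemma tens_unitl_pure (c : k) a : tens_unitl ((c : k^o) \oe a) = c *: a.
Proof. exact: (tens_lift_pure scalel_bilin). Qed.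

Lemma tens_unitr_pure (c : k) a : tens_unitr (a \oe (c : k^o)) = c *: a.
Proof. exact: (tens_lift_pure scaler_bilin). Qed.

End TensorUnit.

Arguments tens_unitl {k A}.
Arguments tens_unitr {k A}.

Section TensorAssoc.
Variables (k : fieldType) (A B C : lmodType k).

Let insr (c : C) (b : B) : B \ox C := b \oe c.
HB.instance Definition _ c := GRing.isLinear.Build k B (B \ox C) _ (insr c)
  (@pure_linearl k B C c).

Let assoc (x : A \ox B) (c : C) : A \ox (B \ox C) :=
  tens_map idfun (insr c) x.

Let assoc_bilin : bilin assoc.
Proof.
split=> [c|x d c c']; first exact: linearP.
rewrite /assoc; elim/tens_ind: x => [a b||x y IHx IHy].
- by rewrite !tens_map_pure /= /insr pure_linearr pure_linearr.
- by rewrite !linear0 addr0.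
- by rewrite !linearD /= IHx IHy addrACA.
Qed.

Definition tens_assoc : (A \ox B) \ox C -> A \ox (B \ox C) := tens_lift assoc.

HB.instance Definition _ := GRing.isLinear.Build k ((A \ox B) \ox C)
  (A \ox (B \ox C)) _ tens_assoc (tens_lift_linear assoc_bilin).

Lemma tens_assoc_pure a b c :
  tens_assoc ((a \oe b) \oe c) = a \oe (b \oe c).
Proof. by rewrite /tens_assoc (tens_lift_pure assoc_bilin) /assoc tens_map_pure. Qed.

End TensorAssoc.

Arguments tens_assoc {k A B C}.

Section TensorAlgebra.
Variables (k : fieldType) (A B : kalgType k).
Implicit Types x y z : A \ox B.

Let mul_pure (a : A) (b : B) (a' : A) (b' : B) : A \ox B :=
  (a * a') \oe (b * b').

Let mul_pure_bilin a b : bilin (mul_pure a b).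
Proof.
split=> [b' c a' a''|a' c b' b'']; rewrite /mul_pure mulrDr -kscalerAr.
- exact: pure_linearl.
- exact: pure_linearr.
Qed.

Let mul_left y (a : A) (b : B) : A \ox B := tens_lift (mul_pure a b) y.

Let mul_left_linear a b : linear (fun y => mul_left y a b).
Proof. exact: tens_lift_linear (mul_pure_bilin a b). Qed.

Let mul_left_bilin y : bilin (mul_left y).
Proof.
split=> [b c a a'|a c b b']; rewrite /mul_left /tens_lift.
- rewrite scaler_sumr -big_split; apply: eq_bigr => -[a1 b1] _ /=.
  by rewrite /mul_pure mulrDl -kscalerAl pure_linearl.
- rewrite scaler_sumr -big_split; apply: eq_bigr => -[a1 b1] _ /=.
  by rewrite /mul_pure mulrDl -kscalerAl pure_linearr.
Qed.

Definition tens_mul x y : A \ox B := tens_lift (mul_left y) x.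

Lemma tens_mul_pure (a a' : A) (b b' : B) :
  tens_mul (a \oe b) (a' \oe b') = (a * a') \oe (b * b').
Proof.
rewrite /tens_mul (tens_lift_pure (mul_left_bilin _)).
exact: (tens_lift_pure (mul_pure_bilin a b)).
Qed.

Fact tens_mul_linearl y : linear (tens_mul^~ y).
Proof. exact: tens_lift_linear (mul_left_bilin y). Qed.

Fact tens_mul_linearr x : linear (tens_mul x).
Proof.
move=> c y z; rewrite /tens_mul /tens_lift scaler_sumr -big_split.
by apply: eq_bigr => -[a b] _ /=; rewrite mul_left_linear.
Qed.

Fact tens_mulDl : left_distributive tens_mul +%R.
Proof.
by move=> x y z; have := tens_mul_linearl z 1 x y; rewrite !scale1r.
Qed.

Fact tens_mulDr : right_distributive tens_mul +%R.
Proof.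
by move=> x y z; have := tens_mul_linearr x 1 y z; rewrite !scale1r.
Qed.

Fact tens_mul0l x : tens_mul 0 x = 0.
Proof. by apply: (addrI (tens_mul 0 x)); rewrite -tens_mulDl !addr0. Qed.

Fact tens_mul0r x : tens_mul x 0 = 0.
Proof. by apply: (addrI (tens_mul x 0)); rewrite -tens_mulDr !addr0. Qed.

Fact tens_mulA : associative tens_mul.
Proof.
move=> x y z; elim/tens_ind: x => [a b||x x' IHx IHx']; first last.
- by rewrite !tens_mulDl IHx IHx'.
- by rewrite !tens_mul0l.
elim/tens_ind: y => [a' b'||y y' IHy IHy']; first last.
- by rewrite tens_mulDl !tens_mulDr IHy IHy' tens_mulDl.
- by rewrite !(tens_mul0l, tens_mul0r).
elim/tens_ind: z => [a'' b''||z z' IHz IHz']; first last.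
- by rewrite !tens_mulDr IHz IHz'.
- by rewrite !tens_mul0r.
by rewrite !tens_mul_pure !mulrA.
Qed.

Fact tens_mul1l : left_id ((1 : A) \oe (1 : B)) tens_mul.
Proof.
elim/tens_ind => [a b||x y IHx IHy]; first by rewrite tens_mul_pure !mul1r.
- exact: tens_mul0r.
- by rewrite tens_mulDr IHx IHy.
Qed.

Fact tens_mul1r : right_id ((1 : A) \oe (1 : B)) tens_mul.
Proof.
elim/tens_ind => [a b||x y IHx IHy]; first by rewrite tens_mul_pure !mulr1.
- exact: tens_mul0l.
- by rewrite tens_mulDl IHx IHy.
Qed.

Fact tens_mulZl (c : k) x y : c *: tens_mul x y = tens_mul (c *: x) y.
Proof.
by have := tens_mul_linearl y c x 0; rewrite /= tens_mul0l !addr0.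
Qed.

Fact tens_mulZr (c : k) x y : c *: tens_mul x y = tens_mul x (c *: y).
Proof. by have := tens_mul_linearr x c y 0; rewrite tens_mul0r !addr0. Qed.

HB.instance Definition _ := Lmodule_isKAlgebra.Build k (A \ox B)
  tens_mulA tens_mul1l tens_mul1r tens_mulDl tens_mulDr tens_mulZl tens_mulZr.
HB.instance Definition _ :=
  GRing.PzRing.copy (A \ox B) ((A \ox B : Type) : kalgType k).

Lemma mul_tens_pure (a a' : A) (b b' : B) :
  (a \oe b) * (a' \oe b') = (a * a') \oe (b * b').
Proof. exact: tens_mul_pure. Qed.

Lemma tens1E : (1 : A \ox B) = (1 : A) \oe (1 : B).
Proof. by []. Qed.

Definition tens_inl (a : A) : A \ox B := a \oe (1 : B).
Definition tens_inr (b : B) : A \ox B := (1 : A) \oe b.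

HB.instance Definition _ := GRing.isLinear.Build k A (A \ox B) _ tens_inl
  (@pure_linearl k A B 1).
HB.instance Definition _ := GRing.isLinear.Build k B (A \ox B) _ tens_inr
  (@pure_linearr k A B 1).

End TensorAlgebra.

Arguments tens_inl {k A B}.
Arguments tens_inr {k A B}.

Section MultiplicationMap.
Variables (k : fieldType) (A : kalgType k).

Let mulA_bilin : bilin (fun a b : A => a * b).
Proof.
by split=> [b c a a'|a c b b'] /=; rewrite (mulrDl, mulrDr) -(kscalerAl, kscalerAr).
Qed.

Definition tens_mult : A \ox A -> A := tens_lift (fun a b : A => a * b).

HB.instance Definition _ := GRing.isLinear.Build k (A \ox A) A _
  tens_mult (tens_lift_linear mulA_bilin).

Lemma tens_mult_pure (a b : A) : tens_mult (a \oe b) = a * b.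
Proof. exact: (tens_lift_pure mulA_bilin). Qed.

End MultiplicationMap.

Arguments tens_mult {k A}.

(* The algebra L(V): the product is the composition of endomorphisms. *)
Section LinearEndomorphisms.
Variables (k : fieldType) (V : vectType k).

Definition lend : Type := 'End(V).

HB.instance Definition _ := Vector.on lend.
HB.instance Definition _ := Lmodule_isKAlgebra.Build k lend
  (@comp_lfunA _ _ _ _ _ : @associative lend _)
  (@comp_lfun1l _ _ _) (@comp_lfun1r _ _ _)
  (@comp_lfunDl _ _ _ _) (@comp_lfunDr _ _ _ _)
  (@comp_lfunZl _ _ _ _) (@comp_lfunZr _ _ _ _).
HB.instance Definition _ := GRing.PzRing.copy lend (lend : kalgType k).

Lemma lendE (f g : lend) (x : V) : (f * g) x = f (g x).
Proof. exact: comp_lfunE. Qed.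

End LinearEndomorphisms.

Notation "''L' ( V )" := (lend V) (at level 8, format "''L' ( V )").

Definition dualv (k : fieldType) (V : vectType k) : vectType k := 'Hom(V, k^o).

Section Transposition.
Variables (k : fieldType) (V : vectType k).

Let precomp (T : 'L(V)) (f : dualv V) : dualv V := (f \o T)%VF.

Let precomp_linear T : linear (precomp T).
Proof. by move=> c f g; rewrite /precomp comp_lfunDl comp_lfunZl. Qed.

HB.instance Definition _ T := GRing.isLinear.Build k (dualv V) (dualv V) _
  (precomp T) (precomp_linear T).

Definition trsp (T : 'L(V)) : 'L(dualv V) := linfun (precomp T).

Lemma trspE (T : 'L(V)) (f : dualv V) : trsp T f = (f \o T)%VF.
Proof. by rewrite /trsp lfunE. Qed.

Fact trsp_linear : linear trsp.
Proof.
move=> c T T'; apply/lfunP=> f.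
by rewrite add_lfunE scale_lfunE !trspE comp_lfunDr comp_lfunZr.
Qed.

HB.instance Definition _ := GRing.isLinear.Build k 'L(V) 'L(dualv V) _
  trsp trsp_linear.

Let eval (x : V) (f : dualv V) : k^o := f x.

Let eval_linear x : linear (eval x).
Proof. by move=> c f g; rewrite /eval add_lfunE scale_lfunE. Qed.

HB.instance Definition _ x := GRing.isLinear.Build k (dualv V) k^o _
  (eval x) (eval_linear x).

Let bidual_fun (x : V) : dualv (dualv V) := linfun (eval x).

Let bidual_fun_linear : linear bidual_fun.
Proof.
move=> c x y; apply/lfunP=> f.
by rewrite add_lfunE scale_lfunE !lfunE /= /eval linearP.
Qed.

HB.instance Definition _ := GRing.isLinear.Build k V (dualv (dualv V)) _
  bidual_fun bidual_fun_linear.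

Definition bidual : 'Hom(V, dualv (dualv V)) := linfun bidual_fun.

Lemma bidualE (x : V) (f : dualv V) : bidual x f = f x.
Proof. by rewrite /bidual !lfunE. Qed.

Lemma bidual_lker0 : lker bidual == 0%VS.
Proof.
apply/eqP/vspaceP=> x; rewrite memv_ker memv0; apply/eqP/eqP=> [x0|->].
  have bV := vbasisP {:V}; rewrite (coord_basis bV (memvf x)).
  apply: big1 => i _; have := congr1 (fun T : 'Hom(_, _) =>
    T (linfun (coord (vbasis {:V}) i : {linear V -> k^o}))) x0.
  by rewrite bidualE !lfunE /= => ->; rewrite scale0r.
by rewrite linear0.
Qed.

End Transposition.

Arguments trsp {k V}.

(* The transposition L(V^* ) -> L(V^** ) = L(V), the identification being
   along the canonical isomorphism bidual. *)
Section BackTransposition.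
Variables (k : fieldType) (V : vectType k).

Definition trsp_back (T : 'L(dualv V)) : 'L(V) :=
  ((bidual V)^-1 \o (trsp T \o bidual V))%VF.

Fact trsp_back_linear : linear trsp_back.
Proof.
move=> c T T'; rewrite /trsp_back linearP.
by rewrite comp_lfunDl comp_lfunDr -comp_lfunZl -comp_lfunZr.
Qed.

HB.instance Definition _ := GRing.isLinear.Build k 'L(dualv V) 'L(V) _
  trsp_back trsp_back_linear.

Lemma trspK : cancel (@trsp k V) trsp_back.
Proof.
move=> T; apply/lfunP=> x; rewrite /trsp_back !comp_lfunE.
have -> : trsp (trsp T) (bidual V x) = bidual V (T x).
  by apply/lfunP=> f; rewrite trspE comp_lfunE !bidualE trspE comp_lfunE.
by rewrite lker0_lfunK // bidual_lker0.
Qed.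

End BackTransposition.

Arguments trsp_back {k V}.

Record hopfType (k : fieldType) := HopfAlgebra {
  hopf_alg :> kalgType k;
  comul : {linear hopf_alg -> hopf_alg \ox hopf_alg};
  counit : {linear hopf_alg -> k^o};
  antipode : {linear hopf_alg -> hopf_alg};
  comul_morph : GRing.monoid_morphism comul;
  counit_morph : GRing.monoid_morphism counit;
  comul_assoc : forall x,
    tens_assoc (tens_map comul idfun (comul x)) =
    tens_map idfun comul (comul x);
  comul_unitl : forall x, tens_unitl (tens_map counit idfun (comul x)) = x;
  comul_unitr : forall x, tens_unitr (tens_map idfun counit (comul x)) = x;
  antipodel : forall x,
    tens_mult (tens_map antipode idfun (comul x)) = (counit x : k) *: (1 : hopf_alg);
  antipoder : forall x,
    tens_mult (tens_map idfun antipode (comul x)) = (counit x : k) *: (1 : hopf_alg)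
}.

Arguments comul {k h}.
Arguments counit {k h}.
Arguments antipode {k h}.

(* The full linear dual H^*, with the convolution product and unit counit.
   The finite dual H° is a subalgebra of H^* stable under f |-> f \o antipode,
   which restricts to its antipode; so <C_pi>, for C_pi in H°, is computed
   below in H^*, without forming the Hopf algebra H°. *)
Section LinearDual.
Variables (k : fieldType) (H : hopfType k).

Definition hdual : Type := {linear H -> k^o}.

HB.instance Definition _ := gen_eqMixin hdual.
HB.instance Definition _ := gen_choiceMixin hdual.

Implicit Types f g h : hdual.

Lemma hdualP f g : f =1 g -> f = g.
Proof.
case: f g => f cf [g cg] /= /funext fg; subst g; congr GRing.Linear.Pack.
case: cf cg => [[p] [q]] [[p'] [q']].
by rewrite (Prop_irrelevance p p') (Prop_irrelevance q q').
Qed.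

Let conv_fun f g (x : H) : k^o := tens_unitl (tens_map f g (comul x)).

Let conv_fun_linear f g : linear (conv_fun f g).
Proof. by move=> c x y; rewrite /conv_fun !linearP. Qed.

HB.instance Definition _ f g := GRing.isLinear.Build k H k^o _
  (conv_fun f g) (conv_fun_linear f g).

Definition hdual_add f g : hdual := f \+ g.
Definition hdual_opp f : hdual := \- f.
Definition hdual_zero : hdual := \0.
Definition hdual_scale (c : k) f : hdual := c \*: f.
Definition hdual_mul f g : hdual := conv_fun f g.
Definition hdual_one : hdual := counit.


Fact hdual_addA : associative hdual_add.
Proof. by move=> f g h; apply: hdualP => x /=; rewrite addrA. Qed.

Fact hdual_addC : commutative hdual_add.
Proof. by move=> f g; apply: hdualP => x /=; rewrite addrC. Qed.

Fact hdual_add0 : left_id hdual_zero hdual_add.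
Proof. by move=> f; apply: hdualP => x /=; rewrite add0r. Qed.

Fact hdual_addN : left_inverse hdual_zero hdual_opp hdual_add.
Proof. by move=> f; apply: hdualP => x /=; rewrite addNr. Qed.

HB.instance Definition _ := GRing.isZmodule.Build hdual
  hdual_addA hdual_addC hdual_add0 hdual_addN.

Fact hdual_scaleA c d f :
  hdual_scale c (hdual_scale d f) = hdual_scale (c * d) f.
Proof. by apply: hdualP => x /=; rewrite scalerA. Qed.

Fact hdual_scale1 : left_id 1 hdual_scale.
Proof. by move=> f; apply: hdualP => x /=; rewrite scale1r. Qed.

Fact hdual_scaleDr : right_distributive hdual_scale +%R.
Proof. by move=> c f g; apply: hdualP => x /=; rewrite scalerDr. Qed.

Fact hdual_scaleDl f : {morph hdual_scale^~ f : c d / c + d}.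
Proof. by move=> c d; apply: hdualP => x /=; rewrite scalerDl. Qed.

HB.instance Definition _ := GRing.Zmodule_isLmodule.Build k hdual
  hdual_scaleA hdual_scale1 hdual_scaleDr hdual_scaleDl.

Lemma hdual_mulE f g x : hdual_mul f g x = tens_unitl (tens_map f g (comul x)).
Proof. by []. Qed.

Fact hdual_mulA : associative hdual_mul.
Proof.
move=> f g h; apply: hdualP => x; rewrite !hdual_mulE.
pose F (t : H \ox (H \ox H)) : k^o :=
  tens_unitl (tens_map f (tens_unitl \o tens_map g h) t).
transitivity (F (tens_map idfun comul (comul x))).
  elim/tens_ind: (comul x) => [a b||s t IHs IHt].
  - by rewrite /F !tens_map_pure.
  - by rewrite /F !linear0.
  - by rewrite /F !linearD /= IHs IHt.
rewrite -comul_assoc; elim/tens_ind: (comul x) => [a b||s t IHs IHt].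
- rewrite /F !tens_map_pure /= hdual_mulE.
  elim/tens_ind: (comul a) => [p q||s t IHs IHt].
  + rewrite tens_assoc_pure !tens_map_pure /= tens_map_pure !tens_unitl_pure.
    by rewrite scalerA.
  + by rewrite pure0l !linear0 /= pure0l linear0.
  + by rewrite pureDl !linearD /= IHs IHt pureDl linearD.
- by rewrite /F !linear0.
- by move: IHs IHt; rewrite /F !linearD /= => -> ->.
Qed.

Fact hdual_mul1l : left_id hdual_one hdual_mul.
Proof.
move=> f; apply: hdualP => x; rewrite hdual_mulE -{2}[x]comul_unitl.
elim/tens_ind: (comul x) => [a b||s t IHs IHt]; last 2 first.
- by rewrite !linear0.
- by rewrite !linearD /= IHs IHt.
by rewrite !tens_map_pure !tens_unitl_pure linearZ.
Qed.

Fact hdual_mul1r : right_id hdual_one hdual_mul.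
Proof.
move=> f; apply: hdualP => x; rewrite hdual_mulE -{2}[x]comul_unitr.
elim/tens_ind: (comul x) => [a b||s t IHs IHt]; last 2 first.
- by rewrite !linear0.
- by rewrite !linearD /= IHs IHt.
by rewrite !tens_map_pure tens_unitl_pure tens_unitr_pure linearZ /= [LHS]mulrC.
Qed.

Fact hdual_mulDl : left_distributive hdual_mul +%R.
Proof.
move=> f g h; apply: hdualP => x.
rewrite -[RHS]/(hdual_mul f h x + hdual_mul g h x) !hdual_mulE.
elim/tens_ind: (comul x) => [a b||s t IHs IHt]; last 2 first.
- by rewrite !linear0 addr0.
- by rewrite !linearD /= IHs IHt addrACA.
by rewrite !tens_map_pure !tens_unitl_pure -scalerDl.
Qed.

Fact hdual_mulDr : right_distributive hdual_mul +%R.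
Proof.
move=> f g h; apply: hdualP => x.
rewrite -[RHS]/(hdual_mul f g x + hdual_mul f h x) !hdual_mulE.
elim/tens_ind: (comul x) => [a b||s t IHs IHt]; last 2 first.
- by rewrite !linear0 addr0.
- by rewrite !linearD /= IHs IHt addrACA.
by rewrite !tens_map_pure !tens_unitl_pure -scalerDr.
Qed.

Fact hdual_mulZl (c : k) f g : c *: hdual_mul f g = hdual_mul (c *: f) g.
Proof.
apply: hdualP => x; rewrite -[LHS]/(c *: hdual_mul f g x) !hdual_mulE.
elim/tens_ind: (comul x) => [a b||s t IHs IHt]; last 2 first.
- by rewrite !linear0.
- by rewrite !linearD /= IHs IHt.
by rewrite !tens_map_pure !tens_unitl_pure scalerA.
Qed.

Fact hdual_mulZr (c : k) f g : c *: hdual_mul f g = hdual_mul f (c *: g).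
Proof.
apply: hdualP => x; rewrite -[LHS]/(c *: hdual_mul f g x) !hdual_mulE.
elim/tens_ind: (comul x) => [a b||s t IHs IHt]; last 2 first.
- by rewrite !linear0.
- by rewrite !linearD /= IHs IHt.
by rewrite !tens_map_pure !tens_unitl_pure !scalerA mulrC.
Qed.

HB.instance Definition _ := Lmodule_isKAlgebra.Build k hdual
  hdual_mulA hdual_mul1l hdual_mul1r hdual_mulDl hdual_mulDr
  hdual_mulZl hdual_mulZr.
HB.instance Definition _ := GRing.PzRing.copy hdual (hdual : kalgType k).

Definition hdual_antipode (f : hdual) : hdual := f \o antipode.

End LinearDual.

Local Open Scope classical_set_scope.

Section GeneratedSubalgebra.
Variables (k : fieldType) (A : kalgType k).

Definition is_subalg (X : set A) : Prop :=
  [/\ X 1, forall x y, X x -> X y -> X (x + y),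
      forall (c : k) x, X x -> X (c *: x) &
      forall x y, X x -> X y -> X (x * y)].

Definition subalg_gen (X : set A) : set A := smallest is_subalg X.

(* <C> : the subalgebra generated by the union of the S^j(C), j >= 0. *)
Definition antipode_gen (S : A -> A) (C : set A) : set A :=
  subalg_gen (\bigcup_j (iter j S @` C)).

End GeneratedSubalgebra.

Section Representations.
Variables (k : fieldType) (V W : vectType k) (H : hopfType k).

(* (id (x) comul) v = v_12 v_13 and (id (x) counit) v = 1. *)
Definition is_corep (v : 'L(V) \ox H) : Prop :=
  tens_map idfun comul v = tens_map idfun tens_inl v * tens_map idfun tens_inr v
  /\ tens_unitr (tens_map idfun counit v) = 1.

Definition corep_coef (v : 'L(V) \ox H) : set H :=
  [set tens_unitl (tens_map f idfun v) | f in [set: {linear 'L(V) -> k^o}]].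

Definition rep_coef (pi : {linear H -> 'L(W)}) : set (hdual H) :=
  [set (f \o pi : hdual H) | f in [set: {linear 'L(W) -> k^o}]].

End Representations.

Record model (k : fieldType) (V W : vectType k) (u : 'L(V) \ox 'L(W)) := Model {
  model_hopf : hopfType k;
  model_corep : 'L(V) \ox model_hopf;
  model_rep : {linear model_hopf -> 'L(W)};
  model_corepP : is_corep model_corep;
  model_repP : GRing.monoid_morphism model_rep;
  modelP : tens_map idfun model_rep model_corep = u
}.

Section Models.
Variables (k : fieldType) (V W : vectType k) (u : 'L(V) \ox 'L(W)).
Implicit Types M N : model u.

Definition left_faithful M : Prop :=
  antipode_gen antipode (corep_coef (model_corep M)) = setT.

(* <C_pi> is dense in H^*: no nonzero element of H is killed by it. *)
Definition right_faithful M : Prop :=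
  forall x : model_hopf M,
    (forall f, antipode_gen (@hdual_antipode k (model_hopf M))
                 (rep_coef (model_rep M)) f -> f x = 0) ->
    x = 0.

Definition bi_faithful M : Prop := left_faithful M /\ right_faithful M.

Record model_mor M N := ModelMor {
  model_fun :> {linear model_hopf M -> model_hopf N};
  model_fun_morph : GRing.monoid_morphism model_fun;
  model_fun_comul : forall x,
    comul (model_fun x) = tens_map model_fun model_fun (comul x);
  model_fun_counit : forall x, counit (model_fun x) = counit x;
  model_fun_antipode : forall x, antipode (model_fun x) = model_fun (antipode x);
  model_fun_corep : tens_map idfun model_fun (model_corep M) = model_corep N;
  model_fun_rep : forall x, model_rep M x = model_rep N (model_fun x)
}.

Definition model_iso M N : Prop :=
  exists (f : model_mor M N) (g : model_mor N M), cancel f g /\ cancel g f.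

Definition maximal_model M : Prop :=
  left_faithful M /\
  forall N, left_faithful N ->
    exists f : model_mor M N, forall g : model_mor M N, g =1 f.

Definition minimal_model M : Prop :=
  left_faithful M /\
  forall N, left_faithful N ->
    exists f : model_mor N M, forall g : model_mor N M, g =1 f.

End Models.

Section TransposeSequence.
Variables (k : fieldType) (V W : vectType k).

Definition altdual (b : bool) : vectType k := if b then dualv V else V.

Definition alttrsp (b : bool) : {linear 'L(altdual b) -> 'L(altdual (~~ b))} :=
  if b return {linear 'L(altdual b) -> 'L(altdual (~~ b))}
  then (trsp_back : {linear 'L(dualv V) -> 'L(V)})
  else (trsp : {linear 'L(V) -> 'L(dualv V)}).

(* u_n, which lives in L(V) (x) L(W) for n even, in L(V^* ) (x) L(W) for n
   odd. *)
Fixpoint trsp_seq (u : 'L(V) \ox 'L(W)) (n : nat) :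
    'L(altdual (odd n)) \ox 'L(W) :=
  if n is m.+1 then tens_map (alttrsp (odd m)) idfun (kinv (trsp_seq u m))
  else u.

End TransposeSequence.

(* Main.v *)
From HB Require Import structures.
From mathcomp Require Import all_boot all_order all_algebra.
From mathcomp Require Import boolp classical_sets.
Require Import Defs.

(** Choose a basis of V, with n elements. For every algebra A this identifies
L(V) (x) A with the n x n matrices over A, and in the dual basis of the dual
space the transposition becomes the transposition of matrices. Condition (iv)
then loses its parity: it says that over L(W) there is a sequence of matrices
starting with the matrix of u, in which every term is the inverse transpose of
the preceding one ([inv_tr_seq], [coord_seqP], [trsp_seq_invertible]). Such a
sequence is determined by its first term, and algebra morphisms preserve it.

A corepresentation v of a Hopf algebra H produces such a sequence over H,
namely v, the transpose of S(v), S^2(v), the transpose of S^3(v), and so on: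
each term is again a multiplicative matrix, hence has its image under S as
inverse ([antip_seq_inv]). Applying pi to it gives (i) => (iv)
([model_invertible]).

Conversely, let F be a class of sequences of iterated inverse transposes with
values in varying algebras. On symbols x(m, i, j), impose all the algebraic
identities that hold in every member of F. The resulting algebra [univ] is a
Hopf algebra as soon as F is stable under three constructions: the constant
sequence 1 over k gives the counit; the convolution of a sequence over A and
one over B, with values in A (x) B, gives the comultiplication; the shift,
with values in the opposite algebra, gives the antipode. If F contains the
sequence of u, this Hopf algebra is a left-faithful model of u
([univ_model_presented]). Two classes matter.
- The class of all sequences of iterated inverse transposes. It contains the
  sequence attached to any model, which therefore receives a morphism: the
  model is maximal ([presented_maximal]).
- The smallest stable class containing the sequence of u. Its members are
  built from u by convolutions and shifts, and the linear forms obtained from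
  them are elements of the algebra generated by the coefficients of pi. By
  construction they separate the points, so the model is bi-faithful
  ([presented_right_faithful]).

Let finally B be a bi-faithful model and N a left-faithful one. The maximal
model M maps onto N and to B. An element of <C_pi> over B, pulled back to M, is
also the pull-back of one over N ([rep_algebra_transport]); hence the kernel of
M -> N is contained in the kernel of M -> B, and the second map factors through
the first. So bi-faithful models are minimal ([bi_faithful_minimal]); since a
minimal model is unique up to isomorphism, it is bi-faithful. *)

Set Implicit Arguments.
Unset Strict Implicit.
Unset Printing Implicit Defensive.

Import GRing.Theory.
Local Open Scope ring_scope.

(** * Tensor products *)

Section TensorMaps.
Variable k : fieldType.

Lemma idfun_monoid (A : kalgType k) : GRing.monoid_morphism (@idfun A).
Proof. by []. Qed.

Lemma comp_monoid (A B C : kalgType k) (f : {linear B -> C})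
    (g : {linear A -> B}) :
  GRing.monoid_morphism f -> GRing.monoid_morphism g ->
  GRing.monoid_morphism (f \o g).
Proof. by move=> [f1 fM] [g1 gM]; split=> [|x y] /=; rewrite ?g1 // gM fM. Qed.

Lemma tens_map_comp (A A' A'' B B' B'' : lmodType k)
    (f : {linear A -> A'}) (f' : {linear A' -> A''})
    (g : {linear B -> B'}) (g' : {linear B' -> B''}) x :
  tens_map f' g' (tens_map f g x) = tens_map (f' \o f) (g' \o g) x.
Proof.
by elim/tens_ind: x => [a b||x y IHx IHy];
  rewrite ?tens_map_pure ?linear0 // !linearD /= IHx IHy.
Qed.

Lemma eq_tens_map (A A' B B' : lmodType k) (f f' : {linear A -> A'})
    (g g' : {linear B -> B'}) :
  f =1 f' -> g =1 g' -> tens_map f g =1 tens_map f' g'.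
Proof.
move=> ff gg; elim/tens_ind=> [a b||x y IHx IHy].
- by rewrite !tens_map_pure ff gg.
- by rewrite !linear0.
- by rewrite !linearD /= IHx IHy.
Qed.

Lemma tens_map_id (A B : lmodType k) (x : A \ox B) : tens_map idfun idfun x = x.
Proof.
by elim/tens_ind: x => [a b||x y IHx IHy];
  rewrite ?tens_map_pure ?linear0 // linearD /= IHx IHy.
Qed.

Lemma tens_map_sum (A A' B B' : lmodType k) (f : {linear A -> A'})
    (g : {linear B -> B'}) (I : Type) (r : seq I) (P : pred I) E :
  tens_map f g (\sum_(i <- r | P i) E i)
  = \sum_(i <- r | P i) tens_map f g (E i).
Proof. exact: linear_sum. Qed.

Lemma tens_map_monoid (A A' B B' : kalgType k) (f : {linear A -> A'})
    (g : {linear B -> B'}) :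
  GRing.monoid_morphism f -> GRing.monoid_morphism g ->
  GRing.monoid_morphism (tens_map f g).
Proof.
move=> [f1 fM] [g1 gM]; split=> [|x y].
  by rewrite tens1E tens_map_pure f1 g1.
elim/tens_ind: x => [a b||x x' IHx IHx']; last 2 first.
- by rewrite mul0r linear0 mul0r.
- by rewrite mulrDl !linearD /= IHx IHx' mulrDl.
elim/tens_ind: y => [a' b'||y y' IHy IHy']; last 2 first.
- by rewrite mulr0 linear0 mulr0.
- by rewrite mulrDr !linearD /= IHy IHy' mulrDr.
by rewrite !(tens_map_pure, mul_tens_pure) fM gM.
Qed.

Lemma tens_assoc_monoid (A B C : kalgType k) :
  GRing.monoid_morphism (@tens_assoc k A B C).
Proof.
split=> [|x y]; first by rewrite !tens1E tens_assoc_pure.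
elim/tens_ind: x => [ab c||x x' IHx IHx']; last 2 first.
- by rewrite mul0r linear0 mul0r.
- by rewrite mulrDl !linearD /= IHx IHx' mulrDl.
elim/tens_ind: y => [ab' c'||y y' IHy IHy']; last 2 first.
- by rewrite mulr0 linear0 mulr0.
- by rewrite mulrDr !linearD /= IHy IHy' mulrDr.
rewrite mul_tens_pure; elim/tens_ind: ab => [a b||x x' IHx IHx']; last 2 first.
- by rewrite mul0r !pure0l linear0 mul0r.
- by rewrite mulrDl !pureDl !linearD /= IHx IHx' mulrDl.
elim/tens_ind: ab' => [a' b'||y y' IHy IHy']; last 2 first.
- by rewrite mulr0 !pure0l linear0 mulr0.
- by rewrite mulrDr !pureDl !linearD /= IHy IHy' mulrDr.
by rewrite !(tens_assoc_pure, mul_tens_pure).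
Qed.

Lemma tens_unitl_monoid (A : kalgType k) :
  GRing.monoid_morphism (@tens_unitl k A).
Proof.
split=> [|x y]; first by rewrite tens1E tens_unitl_pure scale1r.
elim/tens_ind: x => [c a||x x' IHx IHx']; last 2 first.
- by rewrite mul0r linear0 mul0r.
- by rewrite mulrDl !linearD /= IHx IHx' mulrDl.
elim/tens_ind: y => [c' a'||y y' IHy IHy']; last 2 first.
- by rewrite mulr0 linear0 mulr0.
- by rewrite mulrDr !linearD /= IHy IHy' mulrDr.
by rewrite mul_tens_pure !tens_unitl_pure -kscalerAl -kscalerAr scalerA.
Qed.

Lemma tens_unitr_monoid (A : kalgType k) :
  GRing.monoid_morphism (@tens_unitr k A).
Proof.
split=> [|x y]; first by rewrite tens1E tens_unitr_pure scale1r.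
elim/tens_ind: x => [a c||x x' IHx IHx']; last 2 first.
- by rewrite mul0r linear0 mul0r.
- by rewrite mulrDl !linearD /= IHx IHx' mulrDl.
elim/tens_ind: y => [a' c'||y y' IHy IHy']; last 2 first.
- by rewrite mulr0 linear0 mulr0.
- by rewrite mulrDr !linearD /= IHy IHy' mulrDr.
by rewrite mul_tens_pure !tens_unitr_pure -kscalerAl -kscalerAr scalerA.
Qed.

Let flip_bilin (A B : lmodType k) : bilin (fun (a : A) (b : B) => b \oe a).
Proof.
by split=> [b c a a'|a c b b']; rewrite (pure_linearl, pure_linearr).
Qed.

Definition tens_flip (A B : lmodType k) : A \ox B -> B \ox A :=
  tens_lift (fun a b => b \oe a).

HB.instance Definition _ (A B : lmodType k) :=
  GRing.isLinear.Build k (A \ox B) (B \ox A) _ (@tens_flip A B)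
    (tens_lift_linear (flip_bilin A B)).

Lemma tens_flip_pure (A B : lmodType k) (a : A) (b : B) :
  tens_flip (a \oe b) = b \oe a.
Proof. exact: (tens_lift_pure (flip_bilin A B)). Qed.

Lemma pure_sumr (A B : lmodType k) (a : A) (I : Type) (r : seq I)
    (P : pred I) (F : I -> B) :
  a \oe (\sum_(i <- r | P i) F i) = \sum_(i <- r | P i) a \oe F i.
Proof.
by elim/big_rec2: _ => [|i x y _ <-]; rewrite ?pure0r ?pureDr.
Qed.

Lemma pure_suml (A B : lmodType k) (b : B) (I : Type) (r : seq I)
    (P : pred I) (F : I -> A) :
  (\sum_(i <- r | P i) F i) \oe b = \sum_(i <- r | P i) F i \oe b.
Proof.
by elim/big_rec2: _ => [|i x y _ <-]; rewrite ?pure0l ?pureDl.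
Qed.

(** A form of the injectivity of tensor products over a field that avoids bases
of A. Among the expressions of x as a sum of r pure tensors, if some g in G does
not kill the first left factor a, then applying g expresses the first right
factor through the others, and x is a sum of r - 1 pure tensors. *)
Lemma tens_separatel (A B : lmodType k) (G : {linear A -> k^o} -> Prop) :
  (forall a, (forall g, G g -> g a = 0) -> a = 0) ->
  forall x : A \ox B,
  (forall g, G g -> tens_unitl (tens_map g idfun x) = 0) -> x = 0.
Proof.
move=> Gsep x; rewrite [x]tensE; move: (repr x) => {x} s.
have evE t (g : {linear A -> k^o}) :
    tens_unitl (tens_map g idfun (\sum_(p <- t) p.1 \oe p.2))
    = \sum_(p <- t) (g p.1 : k) *: (p.2 : B).
  rewrite (linear_sum (tens_map g idfun)) (linear_sum tens_unitl) /=.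
  apply: eq_bigr => p _; by rewrite tens_map_pure tens_unitl_pure.
move: {2}(size s) (erefl (size s)) => r; elim: r s => [|r IH] [|[a b] s] //=.
  by rewrite big_nil.
move=> [ssz] Gs; rewrite big_cons /=.
have [[g [Gg /eqP ga]]|ga0] := pselect (exists g, G g /\ g a <> 0); last first.
  have a0 : a = 0.
    by apply: Gsep => g Gg; apply: contrapT => ga; apply: ga0; exists g.
  rewrite a0 pure0l add0r; apply: IH => // g /Gs.
  by rewrite !evE big_cons /= a0 linear0 scale0r add0r.
pose c (p : A * B) : k := (g p.1 : k) / g a.
(* The equation (g (x) id) x = 0, solved for b. *)
have bE : b = - \sum_(p <- s) c p *: p.2.
  have := Gs g Gg; rewrite evE big_cons /= => /eqP; rewrite addr_eq0 => /eqP e.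
  apply: (scalerI ga); rewrite e scalerN scaler_sumr; congr (- _).
  by apply: eq_bigr => p _; rewrite scalerA /c mulrC divfK.
(* Substituting b removes the first pure tensor and corrects the other left
factors. *)
pose t := [seq (p.1 - c p *: a, p.2) | p <- s].
have tE : a \oe b + \sum_(p <- s) p.1 \oe p.2 = \sum_(p <- t) p.1 \oe p.2.
  rewrite big_map bE -scaleN1r pureZr pure_sumr scaler_sumr -big_split /=.
  apply: eq_bigr => p _; rewrite pureDl -scaleN1r !pureZl pureZr addrC.
  by rewrite !scaleN1r.
rewrite tE; apply: IH => [|h Gh]; first by rewrite size_map.
by have := Gs h Gh; rewrite big_cons /= tE.
Qed.

End TensorMaps.

Arguments tens_flip {k A B}.

(** * The opposite algebra *)

Section Opposite.
Variables (k : fieldType) (A : kalgType k).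

Definition kopp : Type := A.

HB.instance Definition _ := GRing.Lmodule.copy kopp A.

Let mulo (x y : kopp) : kopp := (y : A) * (x : A).

Fact mulo_A : associative mulo.
Proof. by move=> x y z; rewrite /mulo mulrA. Qed.
Fact mulo_1l : left_id (1 : A) mulo.
Proof. by move=> x; rewrite /mulo mulr1. Qed.
Fact mulo_1r : right_id (1 : A) mulo.
Proof. by move=> x; rewrite /mulo mul1r. Qed.
Fact mulo_Dl : left_distributive mulo +%R.
Proof. by move=> x y z; rewrite /mulo mulrDr. Qed.
Fact mulo_Dr : right_distributive mulo +%R.
Proof. by move=> x y z; rewrite /mulo mulrDl. Qed.
Fact mulo_Zl (c : k) x y : c *: mulo x y = mulo (c *: x) y.
Proof. exact: (kscalerAr c (y : A) (x : A)). Qed.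
Fact mulo_Zr (c : k) x y : c *: mulo x y = mulo x (c *: y).
Proof. exact: (kscalerAl c (y : A) (x : A)). Qed.

HB.instance Definition _ := Lmodule_isKAlgebra.Build k kopp
  mulo_A mulo_1l mulo_1r mulo_Dl mulo_Dr mulo_Zl mulo_Zr.
HB.instance Definition _ := GRing.PzRing.copy kopp (kopp : kalgType k).

End Opposite.

Section KoppMap.
Variables (k : fieldType) (A B : kalgType k) (f : {linear A -> B}).

Definition kopp_map (x : kopp A) : kopp B := f x.

Fact kopp_map_linear : linear kopp_map.
Proof. exact: linearP. Qed.
HB.instance Definition _ := GRing.isLinear.Build k (kopp A) (kopp B) _ kopp_map
  kopp_map_linear.

Lemma kopp_map_monoid :
  GRing.monoid_morphism f -> GRing.monoid_morphism kopp_map.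
Proof. by move=> [f1 fM]; split=> // x y; exact: (fM y x). Qed.

End KoppMap.

(** * Sequences of iterated inverse transposes *)

Section MatrixSequences.
Variables (k : fieldType) (n : nat).

Lemma map_mx_monoidM (A B : kalgType k) (f : {linear A -> B}) (M N : 'M[A]_n) :
  GRing.monoid_morphism f -> map_mx f (M *m N) = map_mx f M *m map_mx f N.
Proof.
move=> [_ fM]; apply/matrixP=> i j; rewrite !mxE linear_sum /=.
by apply: eq_bigr => l _; rewrite !mxE fM.
Qed.

Lemma map_mx_monoid1 (A B : kalgType k) (f : {linear A -> B}) :
  GRing.monoid_morphism f -> map_mx f (1%:M : 'M[A]_n) = 1%:M.
Proof.
move=> [f1 _]; apply/matrixP=> i j; rewrite !mxE.
by case: (i == j); rewrite ?mulr1n ?f1 // !mulr0n linear0.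
Qed.

Lemma mulmx_inv_unique (A : kalgType k) (M N P : 'M[A]_n) :
  N *m M = 1%:M -> M *m P = 1%:M -> N = P.
Proof. by move=> NM MP; rewrite -[N]mulmx1 -MP mulmxA NM mul1mx. Qed.

(** The coordinate form of condition (iv). *)
Definition inv_tr_seq (A : kalgType k) (a : nat -> 'M[A]_n) : Prop :=
  forall m, a m *m (a m.+1)^T = 1%:M /\ (a m.+1)^T *m a m = 1%:M.

Lemma inv_tr_seq_uniq (A : kalgType k) (a b : nat -> 'M[A]_n) :
  inv_tr_seq a -> inv_tr_seq b -> a 0%N = b 0%N -> a =1 b.
Proof.
move=> Ra Rb ab; elim=> // m IH; apply: trmx_inj.
apply: (mulmx_inv_unique (M := a m)); first by case: (Ra m).
by rewrite IH; case: (Rb m).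
Qed.

Definition map_seq (A B : kalgType k) (f : A -> B) (a : nat -> 'M[A]_n) m :=
  map_mx f (a m).

Lemma inv_tr_seq_map (A B : kalgType k) (f : {linear A -> B}) a :
  GRing.monoid_morphism f -> inv_tr_seq a -> inv_tr_seq (map_seq f a).
Proof.
move=> mf Ra m; have [R1 R2] := Ra m.
by rewrite /map_seq matrix.map_trmx -!map_mx_monoidM // R1 R2 map_mx_monoid1.
Qed.

(** A morphism from the universal algebra to A and one to B induce a morphism to
A (x) B through the comultiplication; this is the sequence it corresponds to. *)
Definition conv_seq (A B : kalgType k) (a : nat -> 'M[A]_n)
    (b : nat -> 'M[B]_n) m : 'M[A \ox B]_n :=
  \matrix_(i, j) \sum_l a m i l \oe b m l j.

Lemma conv_seqE (A B : kalgType k) (a : nat -> 'M[A]_n) (b : nat -> 'M[B]_n) m :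
  conv_seq a b m = map_mx tens_inl (a m) *m map_mx tens_inr (b m).
Proof.
apply/matrixP=> i j; rewrite !mxE; apply: eq_bigr => l _.
by rewrite !mxE mul_tens_pure mulr1 mul1r.
Qed.

(** The entries of the two factors commute in A (x) B, which is why
transposition reverses this product, as over a commutative ring. *)
Lemma trmx_inl_inr (A B : kalgType k) (M : 'M[A]_n) (N : 'M[B]_n) :
  (map_mx (@tens_inl k A B) M *m map_mx (@tens_inr k A B) N)^T
  = map_mx tens_inr N^T *m map_mx tens_inl M^T.
Proof.
apply/matrixP=> i j; rewrite !mxE; apply: eq_bigr => l _.
by rewrite !mxE !mul_tens_pure !mulr1 !mul1r.
Qed.

Lemma tens_inl_monoid (A B : kalgType k) :
  GRing.monoid_morphism (@tens_inl k A B).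
Proof. by split=> // x y; rewrite mul_tens_pure mulr1. Qed.

Lemma tens_inr_monoid (A B : kalgType k) :
  GRing.monoid_morphism (@tens_inr k A B).
Proof. by split=> // x y; rewrite mul_tens_pure mulr1. Qed.

Lemma pure_inl_inr (A B : kalgType k) (a : A) (b : B) :
  tens_inl a * tens_inr b = a \oe b.
Proof. by rewrite mul_tens_pure mulr1 mul1r. Qed.

Lemma inv_tr_seq_conv (A B : kalgType k) (a : nat -> 'M[A]_n)
    (b : nat -> 'M[B]_n) :
  inv_tr_seq a -> inv_tr_seq b -> inv_tr_seq (conv_seq a b).
Proof.
move=> Ra Rb m; have [a1 a2] := Ra m; have [b1 b2] := Rb m.
rewrite !conv_seqE trmx_inl_inr; split.
- rewrite mulmxA -[_ *m _ *m map_mx _ (b _)^T]mulmxA.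
  rewrite -map_mx_monoidM ?b1; last exact: tens_inr_monoid.
  rewrite map_mx_monoid1; last exact: tens_inr_monoid.
  rewrite mulmx1 -map_mx_monoidM ?a1; last exact: tens_inl_monoid.
  by rewrite map_mx_monoid1 //; apply: tens_inl_monoid.
- rewrite mulmxA -[_ *m _ *m map_mx _ (a m)]mulmxA.
  rewrite -map_mx_monoidM ?a2; last exact: tens_inl_monoid.
  rewrite map_mx_monoid1; last exact: tens_inl_monoid.
  rewrite mulmx1 -map_mx_monoidM ?b2; last exact: tens_inr_monoid.
  by rewrite map_mx_monoid1 //; apply: tens_inr_monoid.
Qed.

Lemma map_conv_seq (A A' B B' : kalgType k)
    (f : {linear A -> A'}) (g : {linear B -> B'})
    (a : nat -> 'M[A]_n) (b : nat -> 'M[B]_n) :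
  map_seq (tens_map f g) (conv_seq a b) = conv_seq (map_seq f a) (map_seq g b).
Proof.
apply: funext => m; apply/matrixP=> i j; rewrite !mxE tens_map_sum.
by apply: eq_bigr => l _; rewrite tens_map_pure !mxE.
Qed.

Definition unit_seq : nat -> 'M[k^o]_n := fun=> 1%:M.

Lemma inv_tr_seq_unit : inv_tr_seq unit_seq.
Proof. by move=> m; rewrite trmx1 mulmx1. Qed.

(** The sequence attached to the composition with the antipode, which sends the
m-th generating matrix to the transpose of the next one and reverses
products. *)
Definition opp_seq (A : kalgType k) (a : nat -> 'M[A]_n) m : 'M[kopp A]_n :=
  (a m.+1)^T.

Lemma inv_tr_seq_opp (A : kalgType k) (a : nat -> 'M[A]_n) :
  inv_tr_seq a -> inv_tr_seq (opp_seq a).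
Proof.
move=> Ra m; have [a1 a2] := Ra m.+1.
split; apply/matrixP=> i j.
- move/matrixP/(_ j i): a2; rewrite !mxE eq_sym => <-.
  by apply: eq_bigr => l _; rewrite !mxE.
- move/matrixP/(_ j i): a1; rewrite !mxE eq_sym => <-.
  by apply: eq_bigr => l _; rewrite !mxE.
Qed.

End MatrixSequences.

(** * Coordinates on the tensor product of L(V) and an algebra *)

Section Coordinates.
Variables (k : fieldType) (V : vectType k).

Local Notation n := (\dim {:V}).
Local Notation b := (vbasis {:V}).

Definition entry (i j : 'I_n) (T : 'L(V)) : k^o := coord b i (T b`_j).

Fact entry_linear i j : linear (entry i j).
Proof.
by move=> c T T'; rewrite /entry add_lfunE scale_lfunE linearP.
Qed.
HB.instance Definition _ i j := GRing.isLinear.Build k 'L(V) k^o _ (entry i j)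
  (entry_linear i j).

Definition munit_fun (i j : 'I_n) (x : V) : V := coord b j x *: b`_i.

Fact munit_linear i j : linear (munit_fun i j).
Proof. by move=> c x y; rewrite /munit_fun linearP scalerDl scalerA. Qed.
HB.instance Definition _ i j := GRing.isLinear.Build k V V _ (munit_fun i j)
  (munit_linear i j).

Definition munit (i j : 'I_n) : 'L(V) := linfun (munit_fun i j).

Lemma basis_coord (x : V) : x = \sum_i coord b i x *: b`_i.
Proof. exact: (coord_vbasis (memvf x)). Qed.

Lemma coord_basis_delta (i j : 'I_n) : coord b i b`_j = (i == j)%:R.
Proof.
have fb : free b := basis_free (vbasisP _).
by rewrite coord_free // eq_sym.
Qed.

Lemma entry_munit i j i' j' :
  entry i j (munit i' j') = ((i == i') && (j' == j))%:R.
Proof.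
rewrite /entry /munit lfunE /= /munit_fun linearZ /= !coord_basis_delta.
by rewrite -natrM mulnb andbC.
Qed.

Lemma munit_entry (T : 'L(V)) :
  T = \sum_i \sum_j (entry i j T : k) *: munit i j.
Proof.
apply/lfunP=> x; rewrite sum_lfunE {1}[x]basis_coord linear_sum /=.
transitivity (\sum_i \sum_j (entry i j T : k) *: munit i j x); last first.
  apply: eq_bigr => i _; rewrite sum_lfunE; apply: eq_bigr => j _.
  by rewrite scale_lfunE.
rewrite exchange_big; apply: eq_bigr => j _; rewrite linearZ /=.
rewrite {1}[T b`_j]basis_coord scaler_sumr; apply: eq_bigr => i _.
by rewrite /munit lfunE /= /munit_fun !scalerA mulrC.
Qed.

Lemma entryM i j (T T' : 'L(V)) :
  entry i j (T * T') = \sum_l (entry i l T : k) * (entry l j T' : k).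
Proof.
rewrite /entry lendE {1}[T' _]basis_coord !linear_sum /=.
by apply: eq_bigr => l _; rewrite !linearZ /= [LHS]mulrC.
Qed.

Lemma entry1 i j : entry i j (1 : 'L(V)) = (i == j)%:R.
Proof. by rewrite /entry id_lfunE coord_basis_delta. Qed.

Section Algebra.
Variable A : kalgType k.

Definition cord (x : 'L(V) \ox A) : 'M[A]_n :=
  \matrix_(i, j) tens_unitl (tens_map (entry i j) idfun x).

Definition uncord (M : 'M[A]_n) : 'L(V) \ox A :=
  \sum_i \sum_j munit i j \oe M i j.

Lemma cordE x i j : cord x i j = tens_unitl (tens_map (entry i j) idfun x).
Proof. by rewrite mxE. Qed.

Lemma cord_pure T a i j : cord (T \oe a) i j = (entry i j T : k) *: a.
Proof. by rewrite cordE tens_map_pure tens_unitl_pure. Qed.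

Lemma cordD x y : cord (x + y) = cord x + cord y.
Proof. by apply/matrixP=> i j; rewrite [RHS]mxE !cordE !linearD. Qed.

Lemma cord0 : cord 0 = 0.
Proof. by apply/matrixP=> i j; rewrite [RHS]mxE !cordE !linear0. Qed.

Lemma cord_sum (I : Type) (r : seq I) (F : I -> 'L(V) \ox A) :
  cord (\sum_(i <- r) F i) = \sum_(i <- r) cord (F i).
Proof. exact: (big_morph cord cordD cord0). Qed.

Lemma uncordK M : cord (uncord M) = M.
Proof.
apply/matrixP=> i j; rewrite /uncord cord_sum summxE (bigD1 i) //=.
rewrite cord_sum summxE (bigD1 j) //= cord_pure entry_munit !eqxx scale1r.
rewrite !big1 ?addr0 // => [i' ii'|j' jj'].
- rewrite cord_sum summxE big1 // => j' _.
  by rewrite cord_pure entry_munit eq_sym (negPf ii') scale0r.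
- by rewrite cord_pure entry_munit (negPf jj') andbF scale0r.
Qed.

Lemma cordK x : uncord (cord x) = x.
Proof.
elim/tens_ind: x => [T a||x y IHx IHy].
- rewrite {2}[T]munit_entry pure_suml; apply: eq_bigr => i _.
  rewrite pure_suml; apply: eq_bigr => j _.
  by rewrite cord_pure pureZr pureZl.
- rewrite cord0 /uncord big1 // => i _; rewrite big1 // => j _.
  by rewrite mxE pure0r.
- rewrite cordD -[in RHS]IHx -[in RHS]IHy /uncord -big_split /=.
  apply: eq_bigr => i _; rewrite -big_split /=; apply: eq_bigr => j _.
  by rewrite mxE pureDr.
Qed.

Lemma cord_inj : injective cord.
Proof. exact: can_inj cordK. Qed.

Lemma cordM x y : cord (x * y) = cord x *m cord y.
Proof.
elim/tens_ind: x => [T a||x x' IHx IHx']; last 2 first.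
- by rewrite mul0r cord0 mul0mx.
- by rewrite mulrDl !cordD mulmxDl IHx IHx'.
elim/tens_ind: y => [T' a'||y y' IHy IHy']; last 2 first.
- by rewrite mulr0 cord0 mulmx0.
- by rewrite mulrDr !cordD mulmxDr IHy IHy'.
apply/matrixP=> i j; rewrite mul_tens_pure cord_pure entryM scaler_suml mxE.
apply: eq_bigr => l _; rewrite !cord_pure -kscalerAl -kscalerAr scalerA.
by [].
Qed.

Lemma cord1 : cord 1 = 1%:M.
Proof.
apply/matrixP=> i j; rewrite tens1E cord_pure entry1 mxE.
by case: (i == j); rewrite ?scale1r ?scale0r.
Qed.

Lemma invertible_cord x M :
  cord x *m M = 1%:M -> M *m cord x = 1%:M -> invertible x.
Proof.
move=> xM Mx; exists (uncord M).
by split; apply: cord_inj; rewrite cordM cord1 uncordK.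
Qed.

End Algebra.

Lemma cord_map (A B : kalgType k) (f : {linear A -> B}) x :
  cord (tens_map idfun f x) = map_mx f (cord x).
Proof.
apply/matrixP=> i j; rewrite [RHS]mxE.
elim/tens_ind: x => [T a||x y IHx IHy].
- by rewrite tens_map_pure !cord_pure linearZ.
- by rewrite linear0 !cord0 !mxE linear0.
- by rewrite linearD /= !cordD [LHS]mxE IHx IHy [in RHS]mxE linearD.
Qed.

End Coordinates.

Lemma kinvP (k : fieldType) (A : kalgType k) (x : A) :
  invertible x -> x * kinv x = 1 /\ kinv x * x = 1.
Proof. by move=> ix; apply: (xgetPex 0 ix). Qed.

Section DualCoordinates.
Variables (k : fieldType) (V : vectType k).

(** [trsp] is injective, and L(V) has the same dimension as the endomorphism
algebra of the dual. *)
Lemma trsp_backK : cancel (@trsp_back k V) trsp.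
Proof.
pose f := linfun (@trsp k V).
have fE T : f T = trsp T by rewrite /f lfunE.
have kf : lker f == 0%VS.
  apply/lker0P => T T'; rewrite !fE => /(congr1 trsp_back).
  by rewrite !trspK.
have : limg f == fullv.
  rewrite eqEdim subvf limg_dim_eq; last by rewrite (eqP kf) capv0.
  have dd : dim (dualv V) = dim V by apply: muln1.
  rewrite !dimvf [leqLHS]/(dim _ * dim _)%N [leqRHS]/(dim _ * dim _)%N.
  by rewrite !dd leqnn.
move=> /eqP lf T; have : T \in limg f by rewrite lf memvf.
by case/memv_imgP=> T' _ ->; rewrite fE trspK.
Qed.

Lemma trspM (T T' : 'L(V)) : trsp (T * T') = trsp T' * trsp T.
Proof.
by apply/lfunP=> f; rewrite lendE !trspE comp_lfunA.
Qed.

Lemma trsp1 : trsp (1 : 'L(V)) = 1.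
Proof.
by apply/lfunP=> f; rewrite trspE id_lfunE comp_lfun1r.
Qed.

Lemma trsp_backM (T T' : 'L(dualv V)) :
  trsp_back (T * T') = trsp_back T' * trsp_back T.
Proof.
by rewrite -{1}[T]trsp_backK -{1}[T']trsp_backK -trspM trspK.
Qed.

Lemma trsp_back1 : trsp_back (1 : 'L(dualv V)) = 1.
Proof. by rewrite -trsp1 trspK. Qed.

Section Algebra.
Variable A : kalgType k.
Local Notation n := (\dim {:V}).

(** Coordinates on both kinds of terms of the sequence u_n. On the dual side,
transporting to L(V) and transposing the matrix amounts to using the dual
basis; the two reversals of products cancel, so [acord] is multiplicative. *)
Definition acord (c : bool) : 'L(altdual V c) \ox A -> 'M[A]_n :=
  if c return 'L(altdual V c) \ox A -> 'M[A]_n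
  then fun x => (cord (tens_map trsp_back idfun x))^T
  else fun x => cord x.

Lemma acordM c (x y : 'L(altdual V c) \ox A) :
  acord (x * y) = acord x *m acord y :> 'M_n.
Proof.
case: c x y => /= x y; last exact: cordM.
elim/tens_ind: x => [T a||x x' IHx IHx']; last 2 first.
- by rewrite mul0r !linear0 cord0 trmx0 mul0mx.
- by rewrite mulrDl !linearD /= !cordD !linearD /= mulmxDl IHx IHx'.
elim/tens_ind: y => [T' a'||y y' IHy IHy']; last 2 first.
- by rewrite mulr0 !linear0 cord0 trmx0 mulmx0.
- by rewrite mulrDr !linearD /= !cordD !linearD /= mulmxDr IHy IHy'.
apply/matrixP=> i j; rewrite mul_tens_pure !tens_map_pure /= trsp_backM.
rewrite [LHS]mxE cord_pure entryM scaler_suml [RHS]mxE.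
apply: eq_bigr => l _; rewrite ![_^T _ _]mxE !cord_pure -kscalerAl -kscalerAr.
by rewrite scalerA [in LHS]mulrC.
Qed.

Lemma acord1 c : acord (1 : 'L(altdual V c) \ox A) = 1%:M.
Proof.
case: c; rewrite /acord; last exact: cord1.
by rewrite tens1E tens_map_pure /= trsp_back1 -tens1E cord1 trmx1.
Qed.

Lemma acord_alttrsp c (x : 'L(altdual V c) \ox A) :
  acord (tens_map (alttrsp V c) idfun x) = (acord x)^T.
Proof.
case: c x => x; rewrite /= ?trmxK //; congr (cord _)^T.
rewrite tens_map_comp -[RHS]tens_map_id; apply: eq_tens_map => // T.
exact: trspK.
Qed.

Lemma acord_invertible c (x : 'L(altdual V c) \ox A) M :
  acord x *m M = 1%:M -> M *m acord x = 1%:M -> invertible x.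
Proof.
case: c x => x; last exact: invertible_cord.
have inj : injective (@acord true).
  move=> y z /trmx_inj /cord_inj /(congr1 (tens_map (@trsp k V) idfun)).
  rewrite !tens_map_comp.
  have id_eq (w : 'L(dualv V) \ox A) :
    tens_map (trsp \o trsp_back) (idfun \o idfun) w = w.
    rewrite -[RHS]tens_map_id; apply: eq_tens_map => // T; exact: trsp_backK.
  by rewrite !id_eq.
pose y : 'L(altdual V true) \ox A := tens_map trsp idfun (uncord M^T).
have yE : acord y = M.
  rewrite /acord /y tens_map_comp -[RHS]trmxK -[in RHS](uncordK M^T).
  congr (cord _)^T; rewrite -[RHS]tens_map_id.
  by apply: eq_tens_map => // T; exact: trspK.
move=> xM Mx; exists y.
by split; apply: inj; rewrite acordM acord1 yE.
Qed.

End Algebra.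

Section Sequence.
Variables (W : vectType k) (u : 'L(V) \ox 'L(W)).

Definition coord_seq m := acord (trsp_seq u m).

Lemma coord_seqP :
  (forall m, invertible (trsp_seq u m)) -> inv_tr_seq coord_seq.
Proof.
move=> iu m; rewrite /coord_seq /= acord_alttrsp trmxK -!acordM.
by have [-> ->] := kinvP (iu m); rewrite acord1.
Qed.

Lemma trsp_seq_invertible (a : nat -> 'M['L(W)]_(\dim {:V})) :
  inv_tr_seq a -> a 0%N = cord u -> forall m, invertible (trsp_seq u m).
Proof.
move=> Ra a0.
have H m : acord (trsp_seq u m) = a m -> invertible (trsp_seq u m).
  move=> um; have [a1 a2] := Ra m.
  by apply: (@acord_invertible _ _ _ (a m.+1)^T); rewrite um.
move=> m; apply: (H); elim: m => [|m IH]; first by [].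
have [i1 i2] := kinvP (H m IH); have [a1 a2] := Ra m.
rewrite /= acord_alttrsp; apply: trmx_inj; rewrite trmxK.
apply: (mulmx_inv_unique (M := a m)) => //.
by rewrite -IH -acordM i2 acord1.
Qed.

End Sequence.

End DualCoordinates.

(** * Generated subalgebras *)

Section SubalgGen.
Variables (k : fieldType) (A : kalgType k).

Lemma subalg_gen_subalg (C : A -> Prop) : is_subalg (subalg_gen C).
Proof.
split; first by move=> X [[X1 _ _ _] _].
+ by move=> y z Xy Xz X [sX CX]; have [_ XD _ _] := sX; apply: XD;
     [apply: Xy | apply: Xz].
+ by move=> c y Xy X [sX CX]; have [_ _ XZ _] := sX; apply: XZ; apply: Xy.
+ by move=> y z Xy Xz X [sX CX]; have [_ _ _ XM] := sX; apply: XM;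
     [apply: Xy | apply: Xz].
Qed.

Lemma antipode_gen_sub (S : A -> A) (C X : A -> Prop) :
  is_subalg X -> (forall m x, C x -> X (iter m S x)) ->
  forall x, antipode_gen S C x -> X x.
Proof.
move=> sX CX x; apply; split=> // _ [m _ [y Cy <-]]; exact: CX.
Qed.

Lemma antipode_gen_iter (S : A -> A) (C : A -> Prop) m x :
  C x -> antipode_gen S C (iter m S x).
Proof. by move=> Cx X [_]; apply; exists m => //; exists x. Qed.

(** [is_subalg] does not mention 0, which is recovered as a multiple of 1. *)
Lemma is_subalg_sum (X : A -> Prop) (I : Type) (r : seq I)
    (f : I -> A) :
  is_subalg X -> (forall i, X (f i)) -> X (\sum_(i <- r) f i).
Proof.
move=> [X1 XD XZ _] Xf; elim/big_rec: _ => [|i x _ Xx]; last exact: XD.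
by rewrite -(scale0r (1 : A)); apply: XZ.
Qed.

End SubalgGen.

Section GeneratingMatrices.
Variable k : fieldType.

Lemma is_subalg_eq (A B : kalgType k) (f g : {linear A -> B}) :
  GRing.monoid_morphism f -> GRing.monoid_morphism g ->
  is_subalg (fun x => f x = g x).
Proof.
move=> [f1 fM] [g1 gM]; split=> /=.
- by rewrite f1 g1.
- by move=> x y fgx fgy; rewrite !linearD /= fgx fgy.
- by move=> c x fgx; rewrite !linearZ /= fgx.
- by move=> x y fgx fgy; rewrite fM gM fgx fgy.
Qed.

Definition generates n (A : kalgType k) (a : nat -> 'M[A]_n) : Prop :=
  forall X, is_subalg X -> (forall m i j, X (a m i j)) -> forall x, X x.

Lemma generated_ext n (A B : kalgType k) (a : nat -> 'M[A]_n)
    (f g : {linear A -> B}) :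
  generates a -> GRing.monoid_morphism f -> GRing.monoid_morphism g ->
  (forall m i j, f (a m i j) = g (a m i j)) -> f =1 g.
Proof. by move=> ga mf mg fg; exact: (ga _ (is_subalg_eq mf mg) fg). Qed.

End GeneratingMatrices.

(** * Hopf algebras with a generating sequence of matrices *)

Section GeneratedHopf.
Variables (k : fieldType) (n : nat) (Q : kalgType k) (gen : nat -> 'M[Q]_n).
Hypotheses (gen_inv : inv_tr_seq gen) (gen_gen : generates gen).
Variables (D : {linear Q -> Q \ox Q}) (e : {linear Q -> k^o})
  (S : {linear Q -> Q}).
Hypotheses (mD : GRing.monoid_morphism D) (me : GRing.monoid_morphism e).
Hypotheses (S1 : S 1 = 1) (SM : forall x y, S (x * y) = S y * S x).
Hypothesis D_gen : forall m i j,
  D (gen m i j) = \sum_l gen m i l \oe gen m l j.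
Hypothesis e_gen : forall m i j, e (gen m i j) = (i == j)%:R.
Hypothesis S_gen : forall m i j, S (gen m i j) = gen m.+1 j i.

(** Both sides are algebra morphisms in x. *)
Lemma gen_comul_assoc x :
  tens_assoc (tens_map D idfun (D x)) = tens_map idfun D (D x).
Proof.
have mi := idfun_monoid Q.
pose f : {linear Q -> Q \ox (Q \ox Q)} :=
  tens_assoc \o (tens_map D idfun \o D).
pose g : {linear Q -> Q \ox (Q \ox Q)} := tens_map idfun D \o D.
have mf : GRing.monoid_morphism f.
  exact: (comp_monoid (tens_assoc_monoid Q Q Q)
    (comp_monoid (tens_map_monoid mD mi) mD)).
have mg : GRing.monoid_morphism g.
  exact: (comp_monoid (tens_map_monoid mi mD) mD).
apply: (generated_ext gen_gen mf mg) => m i j.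
rewrite /f /g /= D_gen !tens_map_sum (linear_sum tens_assoc).
transitivity (\sum_l \sum_p gen m i p \oe (gen m p l \oe gen m l j)).
  apply: eq_bigr => l _; rewrite tens_map_pure D_gen pure_suml.
  rewrite (linear_sum tens_assoc); apply: eq_bigr => p _.
  exact: tens_assoc_pure.
rewrite exchange_big; apply: eq_bigr => l _ /=.
by rewrite tens_map_pure D_gen pure_sumr.
Qed.

Lemma gen_comul_unitl x : tens_unitl (tens_map e idfun (D x)) = x.
Proof.
have mi := idfun_monoid Q.
pose f : {linear Q -> Q} := tens_unitl \o (tens_map e idfun \o D).
have mf : GRing.monoid_morphism f.
  exact: (comp_monoid (tens_unitl_monoid Q)
    (comp_monoid (tens_map_monoid me mi) mD)).
apply: (generated_ext gen_gen mf mi) => m i j.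
rewrite /f /= D_gen tens_map_sum (linear_sum tens_unitl) (bigD1 i) //=.
rewrite tens_map_pure tens_unitl_pure e_gen eqxx scale1r big1 ?addr0 //.
move=> l li; rewrite tens_map_pure tens_unitl_pure e_gen eq_sym.
by rewrite (negPf li) scale0r.
Qed.

Lemma gen_comul_unitr x : tens_unitr (tens_map idfun e (D x)) = x.
Proof.
have mi := idfun_monoid Q.
pose f : {linear Q -> Q} := tens_unitr \o (tens_map idfun e \o D).
have mf : GRing.monoid_morphism f.
  exact: (comp_monoid (tens_unitr_monoid Q)
    (comp_monoid (tens_map_monoid mi me) mD)).
apply: (generated_ext gen_gen mf mi) => m i j.
rewrite /f /= D_gen tens_map_sum (linear_sum tens_unitr) (bigD1 j) //=.
rewrite tens_map_pure tens_unitr_pure e_gen eqxx scale1r big1 ?addr0 //.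
move=> l lj; rewrite tens_map_pure tens_unitr_pure e_gen.
by rewrite (negPf lj) scale0r.
Qed.

(** The left-hand side is not an algebra morphism in x, but the identity is
stable under products: if it holds at y, then m (S (x) id) (D y * (p (x) q)) is
the multiple by e y of S p * q, because S p and q surround the scalar
m (S (x) id) (D y). *)
Lemma gen_antipodel x :
  tens_mult (tens_map S idfun (D x)) = (e x : k) *: (1 : Q).
Proof.
have [D1 DM] := mD; have [e1 eM] := me.
pose X := fun x : Q =>
  tens_mult (tens_map S idfun (D x)) = (e x : k) *: (1 : Q).
apply: (gen_gen (X := X)) => [|m i j]; last first.
  rewrite /X /= D_gen tens_map_sum (linear_sum tens_mult) e_gen.
  have [_ /matrixP/(_ i j)] := gen_inv m.
  rewrite [LHS](mxE mulmx_key) [RHS]mxE => E.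
  transitivity ((i == j)%:R : Q); last first.
    by case: (i == j); rewrite ?scale1r ?scale0r.
  rewrite -E; apply: eq_bigr => l _.
  by rewrite tens_map_pure /= tens_mult_pure S_gen mxE.
split=> [|y z Xy Xz|c y Xy|y z]; rewrite /X /=.
- by rewrite D1 e1 tens1E tens_map_pure tens_mult_pure S1 mulr1 scale1r.
- by rewrite !linearD /= Xy Xz -scalerDl.
- by rewrite !linearZ /= Xy scalerA.
- rewrite /X /= DM eM => Xy Xz; rewrite -scalerA -Xz.
  elim/tens_ind: (D z) => [p q||s t IHs IHt]; last 2 first.
  + by rewrite mulr0 !linear0 ?scaler0.
  + by rewrite mulrDr !linearD /= IHs IHt.
  rewrite tens_map_pure tens_mult_pure.
  transitivity (S p * tens_mult (tens_map S idfun (D y)) * q).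
    elim/tens_ind: (D y) => [p' q'||s t IHs IHt].
    * by rewrite mul_tens_pure !tens_map_pure !tens_mult_pure SM !mulrA.
    * by rewrite mul0r !linear0 mulr0 mul0r.
    * by rewrite mulrDl !linearD /= IHs IHt mulrDr mulrDl.
  by rewrite Xy -kscalerAr mulr1 -kscalerAl.
Qed.

Lemma gen_antipoder x :
  tens_mult (tens_map idfun S (D x)) = (e x : k) *: (1 : Q).
Proof.
have [D1 DM] := mD; have [e1 eM] := me.
pose X := fun x : Q =>
  tens_mult (tens_map idfun S (D x)) = (e x : k) *: (1 : Q).
apply: (gen_gen (X := X)) => [|m i j]; last first.
  rewrite /X /= D_gen tens_map_sum (linear_sum tens_mult) e_gen.
  have [/matrixP/(_ i j) + _] := gen_inv m.
  rewrite [LHS](mxE mulmx_key) [RHS]mxE => E.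
  transitivity ((i == j)%:R : Q); last first.
    by case: (i == j); rewrite ?scale1r ?scale0r.
  rewrite -E; apply: eq_bigr => l _.
  by rewrite tens_map_pure /= tens_mult_pure S_gen mxE.
split=> [|y z Xy Xz|c y Xy|y z]; rewrite /X /=.
- by rewrite D1 e1 tens1E tens_map_pure tens_mult_pure S1 mulr1 scale1r.
- by rewrite !linearD /= Xy Xz -scalerDl.
- by rewrite !linearZ /= Xy scalerA.
- rewrite /X /= DM eM => Xy Xz.
  rewrite [X in _ = X *: _](mulrC (e y : k)) -scalerA -Xy.
  elim/tens_ind: (D y) => [p q||s t IHs IHt]; last 2 first.
  + by rewrite mul0r !linear0 ?scaler0.
  + by rewrite mulrDl !linearD /= IHs IHt.
  rewrite tens_map_pure tens_mult_pure.
  transitivity (p * tens_mult (tens_map idfun S (D z)) * S q).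
    elim/tens_ind: (D z) => [p' q'||s t IHs IHt].
    * by rewrite mul_tens_pure !tens_map_pure !tens_mult_pure SM !mulrA.
    * by rewrite mulr0 !linear0 mulr0 mul0r.
    * by rewrite mulrDr !linearD /= IHs IHt mulrDr mulrDl.
  by rewrite Xz -kscalerAr mulr1 -kscalerAl.
Qed.

(** The antipode reverses the comultiplication: both sides reverse products, so
that generators suffice. *)
Lemma gen_antipode_comul x : D (S x) = tens_flip (tens_map S S (D x)).
Proof.
have [D1 DM] := mD.
pose X := fun x : Q =>
  D (S x) = tens_flip (tens_map S S (D x)).
apply: (gen_gen (X := X)) => [|m i j]; last first.
  rewrite /X /= S_gen !D_gen tens_map_sum (linear_sum tens_flip).
  apply: eq_bigr => l _.
  by rewrite tens_map_pure /= tens_flip_pure !S_gen.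
split=> [|y z Xy Xz|c y Xy|y z]; rewrite /X /=.
- by rewrite S1 D1 tens1E tens_map_pure tens_flip_pure !S1.
- by rewrite !linearD /= Xy Xz.
- by rewrite !linearZ /= Xy.
- rewrite SM !DM => -> ->.
  elim/tens_ind: (D y) => [p q||s t IHs IHt]; last 2 first.
  + by rewrite mul0r !linear0 mulr0.
  + by rewrite mulrDl !linearD /= mulrDr IHs IHt.
  elim/tens_ind: (D z) => [p' q'||s t IHs IHt].
  + by rewrite !(mul_tens_pure, tens_map_pure, tens_flip_pure) !SM.
  + by rewrite mulr0 !linear0 mul0r.
  + by rewrite mulrDr !linearD /= mulrDl IHs IHt.
Qed.

Definition generated_hopf : hopfType k :=
  HopfAlgebra mD me gen_comul_assoc gen_comul_unitl gen_comul_unitr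
    gen_antipodel gen_antipoder.

End GeneratedHopf.

(** * The universal algebra of a class of matrix sequences *)

Section Terms.
Variables (k : fieldType) (n : nat).

Inductive term : Type :=
| Gen of nat & 'I_n & 'I_n
| Zero
| One
| Add of term & term
| Mul of term & term
| Scale of k & term.

HB.instance Definition _ := gen_eqMixin term.
HB.instance Definition _ := gen_choiceMixin term.

Fixpoint eval (A : kalgType k) (a : nat -> 'M[A]_n) (t : term) : A :=
  match t with
  | Gen m i j => a m i j
  | Zero => 0
  | One => 1
  | Add t t' => eval a t + eval a t'
  | Mul t t' => eval a t * eval a t'
  | Scale c t => c *: eval a t
  end.

Lemma eval_map (A B : kalgType k) (f : {linear A -> B}) a t :
  GRing.monoid_morphism f -> f (eval a t) = eval (map_seq f a) t.
Proof.
move=> [f1 fM]; elim: t => [m i j|||t IH t' IH'|t IH t' IH'|c t IH] /=.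
- by rewrite mxE.
- exact: linear0.
- exact: f1.
- by rewrite linearD IH IH'.
- by rewrite fM IH IH'.
- by rewrite linearZ /= IH.
Qed.

Variable F : forall A : kalgType k, (nat -> 'M[A]_n) -> Prop.
Arguments F {A}.

(** The congruence is defined semantically, by evaluation in the members of F.
The axioms of algebras and all the relations common to the members of F then
hold in the quotient without having to be generated, and the morphisms to the
members of F exist by definition. *)
Definition term_rel : rel term := fun t t' =>
  `[< forall (A : kalgType k) (a : nat -> 'M[A]_n),
        F a -> eval a t = eval a t' >].

Fact term_rel_refl : reflexive term_rel.
Proof. by move=> t; apply/asboolP. Qed.

Fact term_rel_sym : symmetric term_rel.
Proof.
by move=> t t'; apply/asboolP/asboolP => tt A a Fa; rewrite (tt A a Fa).
Qed.

Fact term_rel_trans : transitive term_rel.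
Proof.
move=> t t' t'' /asboolP h /asboolP h'; apply/asboolP => A a Fa.
by rewrite h // h'.
Qed.

Canonical term_equiv := EquivRel term_rel term_rel_refl term_rel_sym
  term_rel_trans.

Definition univ : Type := {eq_quot term_rel}%qT.

HB.instance Definition _ : EqQuotient _ term_rel univ := EqQuotient.on univ.
HB.instance Definition _ := Choice.on univ.

Definition cls (t : term) : univ := \pi_univ%qT t.

Lemma clsP t t' : cls t = cls t' <->
  forall (A : kalgType k) (a : nat -> 'M[A]_n), F a -> eval a t = eval a t'.
Proof. by split=> [/eqmodP/asboolP|h]; last apply/eqmodP/asboolP. Qed.

Lemma clsK (x : univ) : cls (repr x) = x.
Proof. by rewrite /cls reprK. Qed.

Lemma eval_repr (A : kalgType k) (a : nat -> 'M[A]_n) t :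
  F a -> eval a (repr (cls t)) = eval a t.
Proof. by move: A a; apply/clsP; rewrite clsK. Qed.

Definition uadd (x y : univ) : univ := cls (Add (repr x) (repr y)).
Definition umul (x y : univ) : univ := cls (Mul (repr x) (repr y)).
Definition uscale (c : k) (x : univ) : univ := cls (Scale c (repr x)).

(* The right-hand side of some axioms is a variable, which has to be written as
the class of a representative first. *)
Ltac term_axiom :=
  let Fa := fresh in
  move=> *; rewrite /uadd /umul /uscale -1?[RHS]clsK;
  apply/clsP => ? ? Fa /=; rewrite ?(eval_repr _ Fa) /= ?(eval_repr _ Fa) /=.

Fact uaddA : associative uadd.
Proof. by term_axiom; rewrite addrA. Qed.
Fact uaddC : commutative uadd.
Proof. by term_axiom; rewrite addrC. Qed.
Fact uadd0 : left_id (cls Zero) uadd.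
Proof. by term_axiom; rewrite add0r. Qed.
Fact uaddN : left_inverse (cls Zero) (uscale (-1)) uadd.
Proof. by term_axiom; rewrite scaleN1r addNr. Qed.

HB.instance Definition _ := GRing.isZmodule.Build univ uaddA uaddC uadd0 uaddN.

Fact uscaleA c d x : uscale c (uscale d x) = uscale (c * d) x.
Proof. by term_axiom; rewrite scalerA. Qed.
Fact uscale1 : left_id 1 uscale.
Proof. by term_axiom; rewrite scale1r. Qed.
Fact uscaleDr : right_distributive uscale +%R.
Proof. by rewrite /+%R /=; term_axiom; rewrite scalerDr. Qed.
Fact uscaleDl x : {morph uscale^~ x : c d / c + d}.
Proof. by rewrite {2}/+%R /=; term_axiom; rewrite scalerDl. Qed.

HB.instance Definition _ := GRing.Zmodule_isLmodule.Build k univ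
  uscaleA uscale1 uscaleDr uscaleDl.

Fact umulA : associative umul.
Proof. by term_axiom; rewrite mulrA. Qed.
Fact umul1 : left_id (cls One) umul.
Proof. by term_axiom; rewrite mul1r. Qed.
Fact umulr1 : right_id (cls One) umul.
Proof. by term_axiom; rewrite mulr1. Qed.
Fact umulDl : left_distributive umul +%R.
Proof. by rewrite /+%R /=; term_axiom; rewrite mulrDl. Qed.
Fact umulDr : right_distributive umul +%R.
Proof. by rewrite /+%R /=; term_axiom; rewrite mulrDr. Qed.
Fact umulZl (c : k) x y : c *: umul x y = umul (c *: x) y.
Proof. by rewrite /GRing.scale /=; term_axiom; rewrite kscalerAl. Qed.
Fact umulZr (c : k) x y : c *: umul x y = umul x (c *: y).
Proof. by rewrite /GRing.scale /=; term_axiom; rewrite kscalerAr. Qed.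

HB.instance Definition _ := Lmodule_isKAlgebra.Build k univ
  umulA umul1 umulr1 umulDl umulDr umulZl umulZr.
HB.instance Definition _ := GRing.PzRing.copy univ (univ : kalgType k).

End Terms.

Section Universal.
Variables (k : fieldType) (n : nat).
Variable F : forall A : kalgType k, (nat -> 'M[A]_n) -> Prop.
Arguments F {A}.

Local Notation Q := (univ (@F)).

Definition gen m : 'M[Q]_n := \matrix_(i, j) cls (@F) (Gen _ m i j).

Lemma univ_generated : generates gen.
Proof.
move=> X [X1 XD XZ XM] Xg x; rewrite -[x]clsK; elim: (repr x) => {x}.
- by move=> m i j; have := Xg m i j; rewrite mxE.
- rewrite (_ : cls _ _ = (0 : k) *: (1 : Q)); first exact: XZ.
  by rewrite scale0r.
- exact: X1.
- move=> t Xt t' Xt'.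
  suff -> : cls (@F) (Add t t') = cls (@F) t + cls (@F) t' by apply: XD.
  by apply/clsP => A a Fa /=; rewrite !(eval_repr _ Fa).
- move=> t Xt t' Xt'.
  suff -> : cls (@F) (Mul t t') = cls (@F) t * cls (@F) t' by apply: XM.
  by apply/clsP => A a Fa /=; rewrite !(eval_repr _ Fa).
- move=> c t Xt.
  suff -> : cls (@F) (Scale c t) = c *: cls (@F) t by apply: XZ.
  by apply/clsP => A a Fa /=; rewrite !(eval_repr _ Fa).
Qed.

(** The condition for evaluation at a to factor through the universal algebra;
it may hold outside of F, for instance in algebras that embed in a product of
members of F. *)
Definition compatible (A : kalgType k) (a : nat -> 'M[A]_n) : Prop :=
  forall t t', cls (@F) t = cls (@F) t' -> eval a t = eval a t'.

Section Evaluation.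
Variables (A : kalgType k) (a : nat -> 'M[A]_n) (ca : compatible a).

(** The proof of compatibility is an argument so that the linear structure below
can be attached to the function. *)
Definition univ_ev of compatible a := fun x : Q => eval a (repr x).
Local Notation ev := (univ_ev ca).

Lemma univ_ev_cls t : ev (cls (@F) t) = eval a t.
Proof. by apply: ca; rewrite clsK. Qed.

Fact univ_ev_linear : linear ev.
Proof.
move=> c x y.
rewrite [LHS](univ_ev_cls (Add (repr (c *: x)) (repr y))) /=; congr (_ + _).
by rewrite -[LHS]/(ev (c *: x)) [LHS](univ_ev_cls (Scale c (repr x))).
Qed.

HB.instance Definition _ := GRing.isLinear.Build k Q A _ ev univ_ev_linear.

Lemma univ_ev_monoid : GRing.monoid_morphism ev.
Proof.
split=> [|x y]; first exact: (univ_ev_cls (One _ _)).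
exact: (univ_ev_cls (Mul (repr x) (repr y))).
Qed.

Lemma univ_ev_gen m i j : ev (gen m i j) = a m i j.
Proof. by rewrite mxE univ_ev_cls. Qed.

Lemma map_seq_ev_gen : map_seq ev gen = a.
Proof.
apply: funext => m; apply/matrixP=> i j.
by rewrite -univ_ev_gen mxE.
Qed.

End Evaluation.

Lemma in_compatible (A : kalgType k) (a : nat -> 'M[A]_n) :
  F a -> compatible a.
Proof. by move=> Fa t t' /clsP; apply. Qed.

Lemma univ_ext (x y : Q) :
  (forall (A : kalgType k) (a : nat -> 'M[A]_n) (Fa : F a),
    univ_ev (in_compatible Fa) x = univ_ev (in_compatible Fa) y) -> x = y.
Proof.
move=> xy; rewrite -[x]clsK -[y]clsK.
by apply/clsP => A a Fa; apply: (xy A a Fa).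
Qed.

End Universal.

(** * The Hopf structure of the universal algebra *)

Section UniversalHopf.
Variables (k : fieldType) (n : nat).
Variable F : forall A : kalgType k, (nat -> 'M[A]_n) -> Prop.
Hypothesis F_inv : forall (A : kalgType k) (a : nat -> 'M[A]_n),
  F a -> inv_tr_seq a.
Hypothesis F_unit : F (@unit_seq k n).
Hypothesis F_opp : forall (A : kalgType k) (a : nat -> 'M[A]_n),
  F a -> F (opp_seq a).
Local Notation Q := (univ (@F)).
Local Notation gen := (gen (@F)).

Lemma gen_inv : inv_tr_seq gen.
Proof.
move=> m; split; apply/matrixP=> i j; apply: univ_ext => A a Fa.
- have [/matrixP/(_ i j) a1 _] := F_inv Fa m; move: a1.
  rewrite -{1 2}(map_seq_ev_gen (in_compatible Fa)) /map_seq.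
  rewrite matrix.map_trmx -map_mx_monoidM; last exact: univ_ev_monoid.
  rewrite -(map_mx_monoid1 _ (univ_ev_monoid (in_compatible Fa))).
  by rewrite !(mxE map_mx_key) => ->.
- have [_ /matrixP/(_ i j) a1] := F_inv Fa m; move: a1.
  rewrite -{1 2}(map_seq_ev_gen (in_compatible Fa)) /map_seq.
  rewrite matrix.map_trmx -map_mx_monoidM; last exact: univ_ev_monoid.
  rewrite -(map_mx_monoid1 _ (univ_ev_monoid (in_compatible Fa))).
  by rewrite !(mxE map_mx_key) => ->.
Qed.

(** The opposite of the universal algebra is separated by the opposites of the
members of F, and over those the shifted sequence belongs to F. *)
Lemma gen_opp_compatible : compatible (@F) (opp_seq gen).
Proof.
move=> t t' tt; apply: (@univ_ext _ _ _ (_ : Q)) => A a Fa.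
pose f : {linear kopp Q -> kopp A} := kopp_map (univ_ev (in_compatible Fa)).
rewrite -[LHS]/(f _) -[RHS]/(f _).
have mf : GRing.monoid_morphism f by apply/kopp_map_monoid/univ_ev_monoid.
rewrite !eval_map //; have -> : map_seq f (opp_seq gen) = opp_seq a.
  rewrite -[in RHS](map_seq_ev_gen (in_compatible Fa)).
  by apply: funext => m; apply/matrixP=> i j; rewrite !mxE.
exact: (in_compatible (F_opp Fa) tt).
Qed.

(* Stability under convolution is needed in this form, over the tensor square of
the universal algebra. It follows from stability inside F whenever the tensor
square is separated by pairs of members of F. *)
Hypothesis F_conv : compatible (@F) (conv_seq gen gen).

Definition ucomul : {linear Q -> Q \ox Q} := univ_ev F_conv.
Definition ucounit : {linear Q -> k^o} := univ_ev (in_compatible F_unit).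

Definition uantipode_fun (x : Q) : Q := univ_ev gen_opp_compatible x.

Fact uantipode_linear : linear uantipode_fun.
Proof. exact: (univ_ev_linear gen_opp_compatible). Qed.
HB.instance Definition _ := GRing.isLinear.Build k Q Q _ uantipode_fun
  uantipode_linear.
Definition uantipode : {linear Q -> Q} := uantipode_fun.

Lemma ucomul_monoid : GRing.monoid_morphism ucomul.
Proof. exact: univ_ev_monoid. Qed.
Lemma ucounit_monoid : GRing.monoid_morphism ucounit.
Proof. exact: univ_ev_monoid. Qed.

Lemma uantipode1 : uantipode 1 = 1.
Proof. exact: (univ_ev_monoid gen_opp_compatible).1. Qed.
Lemma uantipodeM (x y : Q) : uantipode (x * y) = uantipode y * uantipode x.
Proof. exact: (univ_ev_monoid gen_opp_compatible).2. Qed.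

Lemma ucomul_gen m i j :
  ucomul (gen m i j) = \sum_l gen m i l \oe gen m l j.
Proof. by rewrite /ucomul [LHS]univ_ev_gen mxE. Qed.

Lemma ucounit_gen m i j : ucounit (gen m i j) = (i == j)%:R.
Proof. by rewrite /ucounit [LHS]univ_ev_gen mxE. Qed.

Lemma uantipode_gen m i j : uantipode (gen m i j) = gen m.+1 j i.
Proof. by rewrite [LHS](univ_ev_gen gen_opp_compatible) mxE. Qed.

Definition univ_hopf : hopfType k :=
  generated_hopf gen_inv (univ_generated (F:=F)) ucomul_monoid ucounit_monoid
    uantipode1 uantipodeM ucomul_gen ucounit_gen uantipode_gen.

End UniversalHopf.

(** * Antipodes and multiplicative matrices *)

Section HopfFacts.
Variables (k : fieldType) (H : hopfType k).

Section Convolution.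
Variable A : kalgType k.

Definition conv (f g : {linear H -> A}) (x : H) : A :=
  tens_mult (tens_map f g (comul x)).

Fact conv_linear f g : linear (conv f g).
Proof. by move=> c x y; rewrite /conv !linearP. Qed.
HB.instance Definition _ f g := GRing.isLinear.Build k H A _ (conv f g)
  (conv_linear f g).

Definition conv1 (x : H) : A := (counit x : k) *: (1 : A).

Fact conv1_linear : linear conv1.
Proof. by move=> c x y; rewrite /conv1 linearP scalerDl scalerA. Qed.
HB.instance Definition _ := GRing.isLinear.Build k H A _ conv1 conv1_linear.

Lemma conv_assoc (f g h : {linear H -> A}) :
  conv (conv f g) h =1 conv f (conv g h).
Proof.
move=> x; pose T (t : H \ox (H \ox H)) : A :=
  tens_mult (tens_map f (tens_mult \o tens_map g h) t).
have TD s t : T (s + t) = T s + T t by rewrite /T !linearD.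
have T0 : T 0 = 0 by rewrite /T !linear0.
transitivity (T (tens_map idfun comul (comul x))); last first.
  rewrite /conv; elim/tens_ind: (comul x) => [a b||s t IHs IHt].
  - by rewrite /T !tens_map_pure.
  - by rewrite !linear0 T0.
  - by rewrite !linearD /= TD IHs IHt.
rewrite -comul_assoc /conv; elim/tens_ind: (comul x) => [a b||s t IHs IHt].
- rewrite !tens_map_pure tens_mult_pure /= /conv.
  elim/tens_ind: (comul a) => [p q||s t IHs IHt].
  + rewrite tens_assoc_pure /T !tens_map_pure /= tens_map_pure.
    by rewrite !tens_mult_pure mulrA.
  + by rewrite pure0l !linear0 T0 mul0r.
  + by rewrite pureDl !linearD /= TD mulrDl IHs IHt.
- by rewrite !linear0 T0.
- by rewrite !linearD /= TD IHs IHt.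
Qed.

Lemma conv1l (f : {linear H -> A}) : conv conv1 f =1 f.
Proof.
move=> x; rewrite -{2}[x]comul_unitl /conv.
elim/tens_ind: (comul x) => [a b||s t IHs IHt].
- rewrite !tens_map_pure tens_mult_pure tens_unitl_pure linearZ /= /conv1.
  by rewrite -kscalerAl mul1r.
- by rewrite !linear0.
- by rewrite !linearD /= IHs IHt.
Qed.

Lemma conv1r (f : {linear H -> A}) : conv f conv1 =1 f.
Proof.
move=> x; rewrite -{2}[x]comul_unitr /conv.
elim/tens_ind: (comul x) => [a b||s t IHs IHt].
- rewrite !tens_map_pure tens_mult_pure tens_unitr_pure linearZ /= /conv1.
  by rewrite -kscalerAr mulr1.
- by rewrite !linear0.
- by rewrite !linearD /= IHs IHt.
Qed.

Lemma eq_conv (f f' g g' : {linear H -> A}) :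
  f =1 f' -> g =1 g' -> conv f g =1 conv f' g'.
Proof. by move=> ff gg x; rewrite /conv (eq_tens_map ff gg). Qed.

Lemma conv_inv_unique (f g h : {linear H -> A}) :
  conv f g =1 conv1 -> conv g h =1 conv1 -> f =1 h.
Proof.
move=> fg gh x; rewrite -(conv1r f) -(conv1l h).
rewrite -(eq_conv (frefl f) gh) -(eq_conv fg (frefl h)).
by rewrite conv_assoc.
Qed.

End Convolution.
End HopfFacts.

(** Both antipode \o f and f \o antipode are convolution inverses of f. *)
Lemma bialg_antipode (k : fieldType) (H K : hopfType k) (f : {linear H -> K}) :
  GRing.monoid_morphism f ->
  (forall x, comul (f x) = tens_map f f (comul x)) ->
  (forall x, counit (f x) = counit x) ->
  forall x, antipode (f x) = f (antipode x).
Proof.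
move=> [f1 fM] fD fe.
have fm s : tens_mult (tens_map f f s) = f (tens_mult s).
  elim/tens_ind: s => [a b||s t IHs IHt].
  - by rewrite tens_map_pure !tens_mult_pure fM.
  - by rewrite !linear0.
  - by rewrite !linearD /= IHs IHt.
pose g : {linear H -> K} := antipode \o f.
pose h : {linear H -> K} := f \o antipode.
apply: (conv_inv_unique (f := g) (g := f) (h := h)) => x.
- rewrite /conv1 -fe -antipodel fD /conv tens_map_comp.
  by congr tens_mult; apply: eq_tens_map.
- rewrite /conv1 -f1 -[RHS]linearZ /= -antipoder -fm tens_map_comp /conv.
  by congr tens_mult; apply: eq_tens_map.
Qed.

Section MultiplicativeMatrices.
Variables (k : fieldType) (n : nat) (H : hopfType k).

Definition mult_mx (a : 'M[H]_n) : Prop :=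
  (forall i j, comul (a i j) = \sum_l a i l \oe a l j) /\
  (forall i j, counit (a i j) = (i == j)%:R).

Lemma mult_mx_antipode (a : 'M[H]_n) : mult_mx a ->
  a *m map_mx antipode a = 1%:M /\ map_mx antipode a *m a = 1%:M.
Proof.
move=> [aD ae].
have delta i j : ((i == j)%:R : k) *: (1 : H) = (1%:M : 'M[H]_n) i j.
  by rewrite [RHS]mxE; case: (i == j); rewrite ?scale1r ?scale0r.
split; apply/matrixP=> i j; rewrite -delta -ae.
- rewrite -antipoder aD tens_map_sum (linear_sum tens_mult).
  rewrite [LHS](mxE mulmx_key).
  by apply: eq_bigr => l _; rewrite tens_map_pure /= tens_mult_pure mxE.
- rewrite -antipodel aD tens_map_sum (linear_sum tens_mult).
  rewrite [LHS](mxE mulmx_key).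
  by apply: eq_bigr => l _; rewrite tens_map_pure /= tens_mult_pure mxE.
Qed.

Lemma mult_mxE (a : 'M[H]_n) :
  (forall i j, comul (a i j) = \sum_l a i l \oe a l j) <->
  map_mx comul a = map_mx tens_inl a *m map_mx tens_inr a.
Proof.
split=> [aD|aD i j].
  apply/matrixP=> i j; rewrite [LHS]mxE aD [RHS](mxE mulmx_key).
  by apply: eq_bigr => l _; rewrite ![map_mx _ _ _ _]mxE pure_inl_inr.
move/matrixP/(_ i j): aD; rewrite [LHS]mxE [RHS](mxE mulmx_key) => ->.
by apply: eq_bigr => l _; rewrite ![map_mx _ _ _ _]mxE pure_inl_inr.
Qed.

(** The matrix b = S(a) is the inverse of a. As comul and counit are algebra
morphisms, they are determined on b by their values on a: comul b is the inverse
of the product of the two copies of a, hence the product of the two copies of b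
in the opposite order, and transposition restores the order. *)
Lemma mult_mx_antipode_tr (a : 'M[H]_n) :
  mult_mx a -> mult_mx (map_mx antipode a)^T.
Proof.
move=> ma; have [aS Sa] := mult_mx_antipode ma; have [aD ae] := ma.
have mD := @comul_morph k H; have me := @counit_morph k H.
have ml := @tens_inl_monoid k H H; have mr := @tens_inr_monoid k H H.
set b := map_mx antipode a.
have bD : map_mx comul b = map_mx tens_inr b *m map_mx tens_inl b.
  apply: (mulmx_inv_unique (M := map_mx comul a)).
    by rewrite -map_mx_monoidM // Sa map_mx_monoid1.
  move/mult_mxE: aD => ->; rewrite mulmxA -[_ *m _ *m map_mx tens_inr b]mulmxA.
  rewrite -map_mx_monoidM // aS map_mx_monoid1 // mulmx1.
  by rewrite -map_mx_monoidM // aS map_mx_monoid1.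
have be : map_mx counit b = 1%:M :> 'M[k^o]_n.
  apply: (mulmx_inv_unique (M := map_mx counit a)).
    by rewrite -map_mx_monoidM // Sa map_mx_monoid1.
  rewrite mulmx1; apply/matrixP=> i j.
  by rewrite [LHS]mxE ae [RHS]mxE.
split=> i j.
- rewrite [_^T i j]mxE; move/matrixP/(_ j i): bD; rewrite [LHS]mxE => ->.
  rewrite [LHS](mxE mulmx_key); apply: eq_bigr => l _.
  by rewrite ![_^T _ _]mxE [map_mx tens_inr _ _ _]mxE [map_mx tens_inl _ _ _]mxE
    mul_tens_pure mulr1 mul1r.
- rewrite [_^T i j]mxE; move/matrixP/(_ j i): be; rewrite [LHS]mxE => ->.
  by rewrite [LHS]mxE eq_sym.
Qed.

Variable a : 'M[H]_n.

Definition antip_seq m : 'M[H]_n := iter m (fun b => (map_mx antipode b)^T) a.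

Lemma antip_seq_mult : mult_mx a -> forall m, mult_mx (antip_seq m).
Proof. by move=> ma; elim=> //= m; apply: mult_mx_antipode_tr. Qed.

Lemma antip_seq_inv : mult_mx a -> inv_tr_seq antip_seq.
Proof.
by move=> ma m; rewrite trmxK; apply/mult_mx_antipode/antip_seq_mult.
Qed.

Lemma antip_seqE m i j : antip_seq m i j =
  iter m antipode (if odd m then a j i else a i j).
Proof.
elim: m i j => //= m IH i j; rewrite ![_^T _ _]mxE [map_mx _ _ _ _]mxE IH.
by case: (odd m).
Qed.

End MultiplicativeMatrices.

(** * Models in coordinates *)

Section CoordinateModels.
Variables (k : fieldType) (V W : vectType k).
Local Notation n := (\dim {:V}).

Lemma entry_inj (T T' : 'L(V)) :
  (forall i j, entry i j T = entry i j T') -> T = T'.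
Proof.
move=> TT; rewrite [T]munit_entry [T']munit_entry.
by apply: eq_bigr => i _; apply: eq_bigr => j _; rewrite TT.
Qed.

Lemma entry_unitr (y : 'L(V) \ox k^o) i j :
  entry i j (tens_unitr y) = cord y i j.
Proof.
elim/tens_ind: y => [T c||x y IHx IHy].
- by rewrite tens_unitr_pure cord_pure linearZ /= [LHS]mulrC.
- by rewrite !linear0 cord0 mxE.
- by rewrite !linearD /= cordD IHx IHy [RHS]mxE.
Qed.

Lemma is_corepP (H : hopfType k) (v : 'L(V) \ox H) :
  is_corep v <-> mult_mx (cord v).
Proof.
have eE i j : entry i j (tens_unitr (tens_map idfun counit v))
    = counit (cord v i j).
  by rewrite entry_unitr cord_map mxE.
split=> [[vD ve]|[vD ve]].
- split; last by move=> i j; rewrite -eE ve entry1.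
  by apply/mult_mxE; rewrite -cord_map vD cordM !cord_map.
- split; last by apply: entry_inj => i j; rewrite eE ve entry1.
  by apply: cord_inj; rewrite cordM !cord_map; apply/mult_mxE.
Qed.

Lemma corep_coefE (H : hopfType k) (v : 'L(V) \ox H)
    (f : {linear 'L(V) -> k^o}) :
  tens_unitl (tens_map f idfun v)
  = \sum_i \sum_j (f (munit i j) : k) *: cord v i j.
Proof.
rewrite -{1}[v]cordK tens_map_sum (linear_sum tens_unitl).
apply: eq_bigr => i _; rewrite tens_map_sum (linear_sum tens_unitl).
by apply: eq_bigr => j _; rewrite tens_map_pure /= tens_unitl_pure.
Qed.

Variable u : 'L(V) \ox 'L(W).
Implicit Types M N : model u.

Definition model_mx M : 'M[model_hopf M]_n := cord (model_corep M).

Lemma model_mx_mult M : mult_mx (model_mx M).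
Proof. exact/is_corepP/model_corepP. Qed.

Lemma model_mx_rep M : map_mx (model_rep M) (model_mx M) = cord u.
Proof. by rewrite -cord_map modelP. Qed.

(** The entries of [antip_seq] are those of the S^m(v), up to exchanging the
indices for m odd; they span the spaces S^m(C_v). *)
Lemma left_faithfulP M :
  left_faithful M <-> generates (antip_seq (model_mx M)).
Proof.
split=> [lf X sX Xg x|gM].
- have : (antipode_gen antipode (corep_coef (model_corep M))) x by rewrite lf.
  move/(_ X); apply; split=> // _ [m _ [_ [f _ <-] <-]].
  have [_ _ XZ _] := sX.
  rewrite corep_coefE.
  have iD j (I : Type) (r : seq I) (F : I -> model_hopf M) :
      iter j antipode (\sum_(i <- r) F i) = \sum_(i <- r) iter j antipode (F i).
    by elim: j => //= j ->; rewrite linear_sum.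
  have iZ j (c : k) (y : model_hopf M) :
      iter j antipode (c *: y) = c *: iter j antipode y.
    by elim: j => //= j ->; rewrite linearZ.
  rewrite iD; apply: is_subalg_sum => // i.
  rewrite iD; apply: is_subalg_sum => // j; rewrite iZ; apply: XZ.
  have := antip_seqE (model_mx M) m.
  case: (odd m) => E; first by rewrite -[cord _ i j]/(model_mx M i j) -E.
  by rewrite -[cord _ i j]/(model_mx M i j) -E.
- apply/seteqP; split=> // x _; apply: gM; first exact: subalg_gen_subalg.
  move=> m i j X [_]; apply; exists m => //.
  rewrite antip_seqE /model_mx.
  exists (if odd m then model_mx M j i else model_mx M i j) => //.
  by case: (odd m); [exists (entry j i) | exists (entry i j)];
    rewrite // /model_mx cordE.
Qed.

Lemma model_mor_mx M N (f : model_mor M N) m :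
  map_mx f (antip_seq (model_mx M) m) = antip_seq (model_mx N) m.
Proof.
elim: m => [|m IH] /=; first by rewrite -cord_map model_fun_corep.
rewrite -IH; apply/matrixP=> i j.
by rewrite !mxE model_fun_antipode.
Qed.

Lemma model_mor_uniq M N (f g : model_mor M N) : left_faithful M -> f =1 g.
Proof.
move=> /left_faithfulP gM.
apply: (generated_ext gM (model_fun_morph f) (model_fun_morph g)) => m i j.
by have := model_mor_mx f m; rewrite -(model_mor_mx g m) => /matrixP/(_ i j);
  rewrite !mxE.
Qed.

Lemma model_mor_surj M N (f : model_mor M N) :
  left_faithful N -> forall y, exists x, f x = y.
Proof.
move=> /left_faithfulP gN; have [f1 fM] := model_fun_morph f.
apply: (gN (fun y => exists x, f x = y)) => [|m i j].
  split.
  - by exists 1.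
  - by move=> _ _ [x <-] [y <-]; exists (x + y); rewrite linearD.
  - by move=> c _ [x <-]; exists (c *: x); rewrite linearZ.
  - by move=> _ _ [x <-] [y <-]; exists (x * y); rewrite fM.
by exists (antip_seq (model_mx M) m i j); rewrite -(model_mor_mx f) mxE.
Qed.

Lemma model_seq M (a := map_seq (model_rep M) (antip_seq (model_mx M))) :
  inv_tr_seq a /\ a 0%N = cord u.
Proof.
split; last exact: model_mx_rep.
by apply: (inv_tr_seq_map (model_repP M)); apply/antip_seq_inv/model_mx_mult.
Qed.

Lemma model_invertible M m : invertible (trsp_seq u m).
Proof. by have [Ra a0] := model_seq M; apply: trsp_seq_invertible Ra a0 m. Qed.

Lemma model_mor_id M : exists f : model_mor M M, f =1 id.
Proof.
pose f : {linear model_hopf M -> model_hopf M} := idfun.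
unshelve eexists (ModelMor (model_fun := f) _ _ _ _ _ _) => //.
- by move=> x; rewrite tens_map_id.
- exact: tens_map_id.
Qed.

Lemma model_mor_comp M N P (f : model_mor N P) (g : model_mor M N) :
  exists h : model_mor M P, h =1 f \o g.
Proof.
pose h : {linear model_hopf M -> model_hopf P} := f \o g.
unshelve eexists (ModelMor (model_fun := h) _ _ _ _ _ _) => //.
- exact: comp_monoid (model_fun_morph f) (model_fun_morph g).
- by move=> x; rewrite /h /= !model_fun_comul tens_map_comp.
- by move=> x; rewrite /h /= !model_fun_counit.
- by move=> x; rewrite /h /= !model_fun_antipode.
- rewrite -(model_fun_corep f) -(model_fun_corep g) tens_map_comp.
  exact: eq_tens_map.
- by move=> x; rewrite /h /= -!model_fun_rep.
Qed.

End CoordinateModels.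

(** * The models presented by a class of matrix sequences *)

Section Presentation.
Variables (k : fieldType) (V W : vectType k) (u : 'L(V) \ox 'L(W)).
Local Notation n := (\dim {:V}).
Implicit Types M N : model u.

Definition realizes M (A : kalgType k) (f : {linear model_hopf M -> A})
    (a : nat -> 'M[A]_n) : Prop :=
  GRing.monoid_morphism f /\ map_seq f (antip_seq (model_mx M)) = a.

(** The properties of the Hopf algebra attached to F on which the study of its
models rests. Those of the antipode ensure that f |-> f \o S preserves the
algebra generated by the linear forms obtained from F. *)
Record presented (F : forall A : kalgType k, (nat -> 'M[A]_n) -> Prop) M :
    Prop := Presented {
  presented_gen : generates (antip_seq (model_mx M));
  presented_map : forall (A : kalgType k) (a : nat -> 'M[A]_n), F A a ->
    exists f : {linear model_hopf M -> A}, realizes f a;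
  presented_sep : forall x : model_hopf M,
    (forall (A : kalgType k) (a : nat -> 'M[A]_n) f,
      F A a -> @realizes M A f a -> f x = 0) -> x = 0;
  presented_antipode1 : antipode (1 : model_hopf M) = 1;
  presented_antipodeM : forall x y : model_hopf M,
    antipode (x * y) = antipode y * antipode x;
  presented_comul : forall x : model_hopf M,
    comul (antipode x) = tens_flip (tens_map antipode antipode (comul x));
  presented_counit : forall x : model_hopf M, counit (antipode x) = counit x
}.

Section Existence.
Variable F : forall A : kalgType k, (nat -> 'M[A]_n) -> Prop.
Hypothesis F_inv : forall (A : kalgType k) (a : nat -> 'M[A]_n),
  F a -> inv_tr_seq a.
Hypothesis F_unit : F (@unit_seq k n).
Hypothesis F_opp : forall (A : kalgType k) (a : nat -> 'M[A]_n),
  F a -> F (opp_seq a).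
Hypothesis F_conv : compatible (@F) (conv_seq (gen (@F)) (gen (@F))).
Variable U : nat -> 'M['L(W)]_n.
Hypotheses (FU : F U) (U0 : U 0%N = cord u).

Let H := univ_hopf F_inv F_unit F_opp F_conv.
Let g : nat -> 'M[H]_n := gen (@F).
Let v : 'L(V) \ox H := uncord (g 0%N).
Let pi : {linear H -> 'L(W)} := univ_ev (in_compatible FU).

Lemma univ_corep : is_corep v.
Proof.
apply/is_corepP; rewrite /v uncordK; split=> i j.
- exact: ucomul_gen.
- exact: ucounit_gen.
Qed.

Lemma univ_modelP : tens_map idfun pi v = u.
Proof.
apply: cord_inj; rewrite cord_map /v uncordK -U0.
by apply/matrixP=> i j; rewrite mxE [LHS]univ_ev_gen.
Qed.

Definition univ_model : model u :=
  Model univ_corep (univ_ev_monoid (in_compatible FU)) univ_modelP.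

Lemma univ_model_seq m : antip_seq (model_mx univ_model) m = g m.
Proof.
elim: m => [|m IH]; first exact: uncordK.
rewrite /= IH; apply/matrixP=> i j; rewrite [LHS]mxE [LHS]mxE.
exact: uantipode_gen.
Qed.

Lemma univ_model_presented : presented F univ_model.
Proof.
have seqE : antip_seq (model_mx univ_model) = g.
  by apply: funext => m; apply: univ_model_seq.
split.
- by rewrite seqE; apply: univ_generated.
- move=> A a Fa; exists (univ_ev (in_compatible Fa)); split.
    exact: univ_ev_monoid.
  by rewrite seqE; apply: map_seq_ev_gen.
- move=> x x0; apply: univ_ext => A a Fa.
  rewrite linear0; apply: (x0 A a _ Fa); split; first exact: univ_ev_monoid.
  by rewrite seqE; apply: map_seq_ev_gen.
- exact: uantipode1.
- exact: uantipodeM.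
- exact: (gen_antipode_comul (univ_generated (F:=F))
    (ucomul_monoid F_conv) (uantipode1 F_opp) (uantipodeM F_opp)
    (ucomul_gen F_conv) (uantipode_gen F_opp)).
- move=> x; have [e1 eM] := ucounit_monoid F_unit.
  apply: (univ_generated (X := fun x : univ (@F) =>
    ucounit F_unit (uantipode F_opp x) = ucounit F_unit x)).
    split=> [|y z Xy Xz|c y Xy|y z Xy Xz].
    + by rewrite uantipode1.
    + by rewrite !linearD /= Xy Xz.
    + by rewrite !linearZ /= Xy.
    + by rewrite uantipodeM !eM Xy Xz; apply: mulrC.
  by move=> m i j; rewrite uantipode_gen !ucounit_gen eq_sym.
Qed.

End Existence.

End Presentation.

(** * The maximal model *)

Section Maximal.
Variables (k : fieldType) (V W : vectType k) (u : 'L(V) \ox 'L(W)).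
Local Notation n := (\dim {:V}).

(** The sequence attached to a model N is of the required kind, and gives an
algebra morphism from M to N. It commutes with comultiplications and counits
because both generating sequences consist of multiplicative matrices, and with
the representations because the two sequences over L(W) start with u. *)
Lemma presented_maximal (M : model u) :
  presented (@inv_tr_seq k n) M -> maximal_model M.
Proof.
case=> gM mapM _ _ _ _ _; split=> [|N /left_faithfulP gN].
  exact/left_faithfulP.
set a := antip_seq (model_mx M) in gM mapM.
pose b := antip_seq (model_mx N).
have Rb := antip_seq_inv (model_mx_mult N).
have [f [mf fa]] := mapM _ b Rb.
have faE m i j : f (a m i j) = b m i j by rewrite -fa mxE.
have fD x : comul (f x) = tens_map f f (comul x).
  have mD : GRing.monoid_morphism (comul \o f).
    exact: comp_monoid (@comul_morph k (model_hopf N)) mf.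
  have mf2 : GRing.monoid_morphism (tens_map f f \o comul).
    exact: comp_monoid (tens_map_monoid mf mf) (@comul_morph k (model_hopf M)).
  apply: (generated_ext gM mD mf2) => m i j.
  rewrite /= faE (antip_seq_mult (model_mx_mult N) m).1.
  rewrite (antip_seq_mult (model_mx_mult M) m).1 tens_map_sum.
  by apply: eq_bigr => l _; rewrite tens_map_pure !faE.
have fe x : counit (f x) = counit x.
  have me : GRing.monoid_morphism (counit \o f).
    exact: comp_monoid (@counit_morph k (model_hopf N)) mf.
  apply: (generated_ext gM me (@counit_morph k (model_hopf M))) => m i j.
  rewrite /= faE (antip_seq_mult (model_mx_mult N) m).2.
  by rewrite (antip_seq_mult (model_mx_mult M) m).2.
have fv : tens_map idfun f (model_corep M) = model_corep N.
  apply: cord_inj; rewrite cord_map; apply/matrixP=> i j; rewrite [LHS]mxE.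
  exact: (faE 0%N).
have fr x : model_rep M x = model_rep N (f x).
  have mr : GRing.monoid_morphism (model_rep N \o f).
    exact: comp_monoid (model_repP N) mf.
  apply: (generated_ext gM (model_repP M) mr) => m i j /=; rewrite faE.
  have [RM M0] := model_seq M; have [RN N0] := model_seq N.
  have := inv_tr_seq_uniq RM RN _ m; rewrite M0 N0.
  move=> /(_ erefl) /matrixP/(_ i j).
  by rewrite !mxE.
exists (ModelMor mf fD fe (bialg_antipode mf fD fe) fv fr) => h.
by apply: model_mor_uniq; apply/left_faithfulP.
Qed.

(** For the class of all sequences of iterated inverse transposes, the universal
algebra carries a member of the class, and so does its tensor square. *)
Lemma maximal_exists : (forall m, invertible (trsp_seq u m)) ->
  exists M : model u, maximal_model M.
Proof.
move=> iu; have RU := coord_seqP iu.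
have R_conv : compatible (@inv_tr_seq k n)
    (conv_seq (gen (@inv_tr_seq k n)) (gen (@inv_tr_seq k n))).
  by apply: in_compatible; apply: inv_tr_seq_conv; apply: gen_inv.
pose M := univ_model (F := @inv_tr_seq k n) (fun _ _ => id)
  (@inv_tr_seq_unit k n) (@inv_tr_seq_opp k n) R_conv RU erefl.
by exists M; apply/presented_maximal/univ_model_presented.
Qed.

End Maximal.

(** * The bi-faithful model *)

Section Separation.
Variable k : fieldType.

Definition separates (A : lmodType k) (G : {linear A -> k^o} -> Prop) : Prop :=
  forall a, (forall g, G g -> g a = 0) -> a = 0.

Lemma tens_separate (A B : lmodType k) G G' (x : A \ox B) :
  @separates A G -> @separates B G' ->
  (forall g g', G g -> G' g' -> tens_unitl (tens_map g g' x) = 0) -> x = 0.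
Proof.
move=> sG sG' x0; apply: (tens_separatel sG) => g Gg; apply: sG' => g' Gg'.
rewrite -(x0 g g' Gg Gg'); elim/tens_ind: x {x0} => [a b||x y IHx IHy].
- by rewrite !tens_map_pure !tens_unitl_pure linearZ.
- by rewrite !linear0.
- by rewrite !linearD /= IHx IHy.
Qed.

Definition tens_funs (A B : lmodType k) (G : {linear A -> k^o} -> Prop)
    (G' : {linear B -> k^o} -> Prop) (f : {linear A \ox B -> k^o}) : Prop :=
  exists g g', [/\ G g, G' g' & f =1 tens_unitl \o tens_map g g'].

Lemma separates_tens (A B : lmodType k) G G' :
  @separates A G -> @separates B G' -> separates (tens_funs G G').
Proof.
move=> sG sG' x x0; apply: (tens_separate sG sG') => g g' Gg Gg'.
by apply: (x0 (tens_unitl \o tens_map g g')); exists g, g'; split.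
Qed.

End Separation.

Section DualAntipode.
Variables (k : fieldType) (H : hopfType k).

Lemma hdual_mulrE (f g : hdual H) (x : H) :
  (f * g) x = tens_unitl (tens_map f g (comul x)).
Proof. by []. Qed.

Lemma hdual_oneE (x : H) : (1 : hdual H) x = counit x.
Proof. by []. Qed.

Lemma iter_hdual_antipode m (f : hdual H) x :
  iter m (@hdual_antipode k H) f x = f (iter m antipode x).
Proof. by elim: m x => //= m IH x; rewrite IH -iterSr. Qed.

Hypothesis comul_antipode : forall x : H,
  comul (antipode x) = tens_flip (tens_map antipode antipode (comul x)).
Hypothesis counit_antipode : forall x : H, counit (antipode x) = counit x.

(** f |-> f \o S reverses convolution products, since S reverses
comultiplications. *)
Lemma antipode_gen_hdual (C : hdual H -> Prop) f :
  antipode_gen (@hdual_antipode k H) C f ->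
  antipode_gen (@hdual_antipode k H) C (hdual_antipode f).
Proof.
set X := antipode_gen _ _; have [X1 XD XZ XM] : is_subalg X.
  exact: subalg_gen_subalg.
move: f; apply: (antipode_gen_sub (X := X \o @hdual_antipode k H)) => [|m f Cf].
  split=> /=.
  - have -> // : hdual_antipode (1 : hdual H) = 1.
    by apply: hdualP => x; rewrite hdual_oneE /= counit_antipode.
  - move=> f g Xf Xg.
    have -> : hdual_antipode (f + g) = hdual_antipode f + hdual_antipode g.
      by apply: hdualP => x.
    exact: XD.
  - move=> c f Xf.
    have -> : hdual_antipode (c *: f) = c *: hdual_antipode f.
      by apply: hdualP => x.
    exact: XZ.
  - move=> f g Xf Xg.
    have -> : hdual_antipode (f * g) = hdual_antipode g * hdual_antipode f.
      apply: hdualP => x; rewrite -[LHS]/((f * g) (antipode x)).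
      rewrite !hdual_mulrE comul_antipode.
      elim/tens_ind: (comul x) => [a b||s t IHs IHt].
      + rewrite !tens_map_pure tens_flip_pure tens_map_pure !tens_unitl_pure /=.
        by rewrite [LHS]mulrC.
      + by rewrite !linear0.
      + by rewrite !linearD /= IHs IHt.
    exact: XM.
exact: (antipode_gen_iter (S := @hdual_antipode k H) m.+1 Cf).
Qed.

End DualAntipode.

Section Minimal.
Variables (k : fieldType) (V W : vectType k) (u : 'L(V) \ox 'L(W)).
Local Notation n := (\dim {:V}).

(** The smallest class that yields a model: up to the order of the factors, its
members are the convolutions of shifts of U, with values in tensor products of
copies of L(W) and of its opposite. *)
Inductive tensor_class (U : nat -> 'M['L(W)]_n) :
    forall A : kalgType k, (nat -> 'M[A]_n) -> Prop :=
| TensorUnit : tensor_class U (@unit_seq k n)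
| TensorBase : tensor_class U U
| TensorConv (A B : kalgType k) (a : nat -> 'M[A]_n) (b : nat -> 'M[B]_n) :
    tensor_class U a -> tensor_class U b -> tensor_class U (conv_seq a b)
| TensorOpp (A : kalgType k) (a : nat -> 'M[A]_n) :
    tensor_class U a -> tensor_class U (opp_seq a).

Lemma tensor_class_inv U : inv_tr_seq U ->
  forall (A : kalgType k) (a : nat -> 'M[A]_n),
  tensor_class U a -> inv_tr_seq a.
Proof.
move=> RU A a; elim=> {A a} [||A B a b _ Ra _ Rb|A a _ Ra] //.
- exact: inv_tr_seq_unit.
- exact: inv_tr_seq_conv.
- exact: inv_tr_seq_opp.
Qed.

Lemma separates_unit : separates (fun f : {linear k^o -> k^o} => f =1 id).
Proof.
by move=> c c0; apply: (c0 idfun).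
Qed.

Lemma separates_end : separates (fun _ : {linear 'L(W) -> k^o} => True).
Proof.
move=> T T0; apply: entry_inj => i j.
by rewrite linear0; apply: (T0 (entry i j)).
Qed.

Lemma tensor_class_separated U (A : kalgType k) (a : nat -> 'M[A]_n) :
  tensor_class U a -> separates (fun _ : {linear A -> k^o} => True).
Proof.
elim=> {A a} [||A B a b _ sA _ sB|A a _ sA].
- by move=> c c0; apply: (c0 idfun).
- exact: separates_end.
- move=> x x0; apply: (tens_separate sA sB) => f g _ _.
  exact: (x0 (tens_unitl \o tens_map f g)).
- move=> x x0; apply: (sA x) => f _; exact: (x0 f).
Qed.

(** The algebras in the class are finite dimensional, so linear forms separate
their points; composed with the evaluations, they separate the points of the
universal algebra, hence of its tensor square. *)
Lemma tensor_class_conv U (F := @tensor_class U) :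
  compatible F (conv_seq (gen F) (gen F)).
Proof.
move=> t t' tt; apply/eqP; rewrite -subr_eq0; apply/eqP.
pose G (f : {linear univ F -> k^o}) := exists (A : kalgType k)
  (a : nat -> 'M[A]_n) (Fa : F A a) (g : {linear A -> k^o}),
  f =1 g \o univ_ev (in_compatible Fa).
have sG : separates G.
  move=> x x0; apply: univ_ext => A a Fa; rewrite linear0.
  apply: (tensor_class_separated Fa) => g _.
  by apply: (x0 (g \o univ_ev (in_compatible Fa))); exists A, a, Fa, g.
apply: (tens_separate sG sG) => f f' [A [a [Fa [g fE]]]] [B [b [Fb [h hE]]]].
rewrite (eq_tens_map fE hE) -tens_map_comp linearB /=.
have mab := tens_map_monoid (univ_ev_monoid (in_compatible Fa))
  (univ_ev_monoid (in_compatible Fb)).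
rewrite !(eval_map _ _ mab) map_conv_seq !map_seq_ev_gen.
by rewrite (in_compatible (TensorConv Fa Fb) tt) subrr !linear0.
Qed.

(** Each algebra A in the class has a separating set G of linear forms whose
compositions with the morphism to A lie in the algebra generated by the
coefficients of pi and stable under the antipode. This follows the construction
of A: the unit gives the counit, L(W) gives the coefficients of pi, convolutions
give products, and shifts give compositions with the antipode. *)
Lemma presented_right_faithful U (M : model u) :
  U = map_seq (model_rep M) (antip_seq (model_mx M)) ->
  presented (@tensor_class U) M -> right_faithful M.
Proof.
move=> UE [gM mapM sepM S1 SM DS eS] x x0.
set AG := antipode_gen _ _ in x0.
set s := antip_seq (model_mx M) in UE gM mapM sepM.
have sAG : is_subalg AG by exact: subalg_gen_subalg.
suff K (A : kalgType k) (a : nat -> 'M[A]_n) : tensor_class U a ->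
    exists2 G : {linear A -> k^o} -> Prop, separates G &
    forall f g, realizes (M := M) f a -> G g -> AG (g \o f).
  apply: sepM => A a f Fa ra; have [G sG GA] := K A a Fa.
  by apply: sG => g Gg; apply: (x0 _ (GA f g ra Gg)).
elim=> {A a} [||A B a b Fa [G sG GA] Fb [G' sG' GB]|A a Fa [G sG GA]].
- exists (fun f => f =1 id) => [|f g [mf fs] gid]; first exact: separates_unit.
  have -> : (g \o f : hdual (model_hopf M)) = 1; last by case: sAG.
  apply: hdualP => y; rewrite /= gid hdual_oneE.
  apply: (generated_ext gM mf (@counit_morph k (model_hopf M))) => m i j.
  rewrite (antip_seq_mult (model_mx_mult M) m).2.
  by have /matrixP/(_ i j) := congr1 (@^~ m) fs; rewrite !mxE.
- exists (fun=> True) => [|f g [mf fs] _]; first exact: separates_end.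
  have -> : (g \o f : hdual (model_hopf M)) = g \o model_rep M.
    apply: hdualP => y /=; congr (g _).
    apply: (generated_ext gM mf (model_repP M)) => m i j.
    have := congr1 (@^~ m) fs; rewrite UE => /matrixP/(_ i j).
    by rewrite !mxE.
  have Cg : rep_coef (model_rep M) (g \o model_rep M) by exists g.
  exact: (antipode_gen_iter (S := @hdual_antipode k _) 0 Cg).
- exists (tens_funs G G'); first exact: separates_tens.
  move=> f h [mf fs] [g [g' [Gg Gg' hE]]].
  have [fa [ma sa]] := mapM _ _ Fa; have [fb [mb sb]] := mapM _ _ Fb.
  have fE : f =1 tens_map fa fb \o comul.
    have mab : GRing.monoid_morphism (tens_map fa fb \o comul).
      exact: comp_monoid (tens_map_monoid ma mb)
        (@comul_morph k (model_hopf M)).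
    apply: (generated_ext gM mf mab) => m i j /=.
    rewrite (antip_seq_mult (model_mx_mult M) m).1 tens_map_sum.
    have /matrixP/(_ i j) := congr1 (@^~ m) fs; rewrite [LHS]mxE => ->.
    rewrite -sa -sb mxE; apply: eq_bigr => l _.
    by rewrite tens_map_pure !mxE.
  have -> : (h \o f : hdual (model_hopf M))
      = (g \o fa : hdual (model_hopf M)) * (g' \o fb : hdual (model_hopf M)).
    apply: hdualP => y; rewrite hdual_mulrE /= hE fE /= tens_map_comp.
    by congr tens_unitl; apply: eq_tens_map.
  have [_ _ _ AGM] := sAG.
  by apply: AGM; [apply: GA | apply: GB].
- exists G => [|f g [mf fs] Gg]; first exact: sG.
  have [fa [[fa1 faM] sa]] := mapM _ _ Fa.
  have fE : f =1 fa \o antipode.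
    pose h : {linear model_hopf M -> kopp A} := fa \o antipode.
    have mh : GRing.monoid_morphism h.
      by split=> [|y z]; rewrite /h /= ?S1 ?fa1 // SM faM.
    apply: (generated_ext gM mf mh) => m i j.
    have := congr1 (@^~ m) fs; rewrite -sa => /matrixP/(_ i j).
    by rewrite [LHS]mxE => ->; rewrite /h /= !mxE.
  have -> : (g \o f : hdual (model_hopf M))
      = hdual_antipode ((g : {linear A -> k^o}) \o fa : hdual (model_hopf M)).
    by apply: hdualP => y /=; rewrite fE.
  by apply: antipode_gen_hdual => //; apply: GA.
Qed.

Lemma bi_faithful_exists : (forall m, invertible (trsp_seq u m)) ->
  exists M : model u, bi_faithful M.
Proof.
move=> iu; have RU := coord_seqP iu.
pose F := @tensor_class (coord_seq u).
pose M := univ_model (F := F) (tensor_class_inv RU) (TensorUnit _)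
  (@TensorOpp _) (@tensor_class_conv _) (TensorBase _) erefl.
have pM : presented F M by apply: univ_model_presented.
exists M; split; first by apply/left_faithfulP; case: pM.
apply: (presented_right_faithful (U := coord_seq u)) => //.
have [RM M0] := model_seq M; apply: funext.
exact: inv_tr_seq_uniq RU RM (esym M0).
Qed.

End Minimal.

(** * Bi-faithful models are minimal *)

Section BiFaithful.
Variables (k : fieldType) (V W : vectType k) (u : 'L(V) \ox 'L(W)).
Implicit Types M N B : model u.

Lemma linear_pack (A B : lmodType k) (f : A -> B) :
  linear f -> exists g : {linear A -> B}, g =1 f.
Proof.
move=> lf; pose m := GRing.isLinear.Build k A B _ f lf.
by exists (HB.pack_for {linear A -> B} f m).
Qed.

Definition rep_algebra M : hdual (model_hopf M) -> Prop :=
  antipode_gen (@hdual_antipode k (model_hopf M)) (rep_coef (model_rep M)).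

(** The coefficients of the representations of N and of B have the same
pull-back to M, and pulling back commutes with products and antipodes. *)
Lemma rep_algebra_transport M N B (p : model_mor M N) (q : model_mor M B) f :
  rep_algebra f -> exists2 f', rep_algebra f' & f \o q =1 f' \o p :> (_ -> k^o).
Proof.
have [q1 qM] := model_fun_morph q; have [p1 pM] := model_fun_morph p.
have [S1 SD SZ SM] : is_subalg (@rep_algebra N) := subalg_gen_subalg _.
move: f; apply: antipode_gen_sub => [|m _ [g _ <-]].
  split.
  - by exists 1 => // y; rewrite /= !hdual_oneE !model_fun_counit.
  - move=> h l [h' Sh hE] [l' Sl lE]; exists (h' + l'); first exact: SD.
    by move=> y; rewrite -[LHS]/(h (q y) + l (q y))
      -[RHS]/(h' (p y) + l' (p y)) [h _]hE [l _]lE.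
  - move=> c h [h' Sh hE]; exists (c *: h'); first exact: SZ.
    by move=> y; rewrite -[LHS]/(c *: h (q y)) -[RHS]/(c *: h' (p y)) [h _]hE.
  - move=> h l [h' Sh hE] [l' Sl lE]; exists (h' * l'); first exact: SM.
    move=> y; rewrite -[LHS]/((h * l) (q y)) -[RHS]/((h' * l') (p y)).
    rewrite !hdual_mulrE !model_fun_comul !tens_map_comp.
    by congr tens_unitl; apply: eq_tens_map.
exists (iter m (@hdual_antipode k _) (g \o model_rep N)).
  by apply: antipode_gen_iter; exists g.
move=> y; rewrite /= !iter_hdual_antipode /=; congr (g _).
have qi : iter m antipode (q y) = q (iter m antipode y).
  by elim: m => //= m ->; rewrite model_fun_antipode.
have pi : iter m antipode (p y) = p (iter m antipode y).
  by elim: m {qi} => //= m ->; rewrite model_fun_antipode.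
by rewrite qi pi -!model_fun_rep.
Qed.

Lemma right_faithful_ker M N B (p : model_mor M N) (q : model_mor M B) x :
  right_faithful B -> (forall f, @rep_algebra N f -> f (p x) = 0) -> q x = 0.
Proof.
move=> rB px0; apply: rB => f /(rep_algebra_transport p q) [f' Sf' fE].
by rewrite [LHS]fE; apply: px0.
Qed.

(** As p is onto, the map is determined by q on preimages, and inherits the
properties of q. *)
Lemma model_mor_factor M N B (p : model_mor M N) (q : model_mor M B) :
  left_faithful N -> (forall x, p x = 0 -> q x = 0) ->
  exists h : model_mor N B, True.
Proof.
move=> lN kpq; have [s sK] := choice (model_mor_surj p lN).
have hp x : q (s (p x)) = q x.
  apply/eqP; rewrite -subr_eq0 -linearB; apply/eqP/kpq.
  by rewrite linearB /= sK subrr.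
have [q1 qM] := model_fun_morph q; have [p1 pM] := model_fun_morph p.
have [|h hE] := @linear_pack (model_hopf N) (model_hopf B) (q \o s).
  move=> c x y; rewrite -[x]sK -[y]sK /= -linearP !hp.
  exact: linearP.
have hpE x : h (p x) = q x by rewrite hE /= hp.
have qhp : q =1 h \o p by move=> x; rewrite /= hpE.
unshelve eexists (ModelMor (model_fun := h) _ _ _ _ _ _) => //.
- split=> [|x y]; first by rewrite -p1 hpE.
  by rewrite -[x]sK -[y]sK -pM !hpE qM.
- move=> x; rewrite -[x]sK hpE !model_fun_comul tens_map_comp.
  exact: eq_tens_map.
- by move=> x; rewrite -[x]sK hpE !model_fun_counit.
- by move=> x; rewrite -[x]sK model_fun_antipode !hpE model_fun_antipode.
- rewrite -(model_fun_corep p) -(model_fun_corep q) tens_map_comp.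
  by apply: eq_tens_map => // x; rewrite qhp.
- by move=> x; rewrite -[x]sK hpE -!model_fun_rep.
Qed.

Lemma bi_faithful_minimal B : (exists M : model u, maximal_model M) ->
  bi_faithful B -> minimal_model B.
Proof.
move=> [M [lM maxM]] [lB rB]; split=> // N lN.
have [p _] := maxM N lN; have [q _] := maxM B lB.
have [x px0|h _] := model_mor_factor (p := p) (q := q) lN.
  by apply: (right_faithful_ker (p := p)) => // f _; rewrite px0 linear0.
by exists h => g; apply: model_mor_uniq.
Qed.

Lemma minimal_iso M N : minimal_model M -> minimal_model N -> model_iso M N.
Proof.
move=> [lM mM] [lN mN]; have [f _] := mN M lM; have [g _] := mM N lN.
have [gf gfE] := model_mor_comp g f; have [fg fgE] := model_mor_comp f g.
have [iM iME] := model_mor_id M; have [iN iNE] := model_mor_id N.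
exists f, g; split=> x.
- by rewrite -[RHS]iME -(model_mor_uniq gf iM lM) gfE.
- by rewrite -[RHS]iNE -(model_mor_uniq fg iN lN) fgE.
Qed.

(** Right-faithfulness is transported along the isomorphism with B. *)
Lemma minimal_bi_faithful B M : bi_faithful B -> minimal_model B ->
  minimal_model M -> bi_faithful M.
Proof.
move=> [_ rB] mB mM; split=> [|x x0]; first by case: mM.
have [f [g [fK _]]] := minimal_iso mM mB.
have [i iE] := model_mor_id M.
rewrite -[x]fK (_ : f x = 0) ?linear0 //.
by apply: (right_faithful_ker (p := i)) => // h Sh; rewrite iE; apply: x0.
Qed.

End BiFaithful.

Theorem theorem1p1 (k : fieldType) (V W : vectType k) (u : 'L(V) \ox 'L(W)) :
  [<-> exists M : model u, True;
       exists M : model u, maximal_model M;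
       exists M : model u, minimal_model M;
       forall n : nat, invertible (trsp_seq u n)]
  /\
  ((forall n : nat, invertible (trsp_seq u n)) ->
    [/\ exists M : model u, bi_faithful M,
        forall M N : model u, bi_faithful M -> bi_faithful N -> model_iso M N &
        forall M : model u, minimal_model M <-> bi_faithful M]).
Proof.
have inv (M : model u) : forall n : nat, invertible (trsp_seq u n).
  exact: model_invertible.
split=> [|iu].
  tfae.
  - by case=> M _; apply/maximal_exists/inv.
  - move=> [M maxM]; have [B bB] := bi_faithful_exists (inv M).
    by exists B; apply: bi_faithful_minimal => //; exists M.
  - by case=> M _; apply: inv.
  - by move=> /maximal_exists [M _]; exists M.
have emax := maximal_exists iu; have [B bB] := bi_faithful_exists iu.
split; first by exists B.
  by move=> M N bM bN; apply: minimal_iso; apply: bi_faithful_minimal.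
move=> M; split; last exact: bi_faithful_minimal.
exact: (minimal_bi_faithful bB (bi_faithful_minimal emax bB)).
Qed.
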